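(* There is a function $\varepsilon(d)=O(1/d)$ (as $d\to\infty$) such that the following holds. For every integer $d\ge2$, every problem instance with $u_{ij}\le c_j/d$ for all $i\in[n]$, $j\in[m]$, and every optimal solution $x^*$ of the linear program (LP) of the context, the Modified Large-or-Small algorithm ($MLS$) with parameter $d$ satisfies $$\mathbf{E}[\mathrm{MLS}(I)]\ \ge\ \Big(1-\frac{1}{\sqrt{2\pi d}}+\varepsilon(d)\Big)\,\mathbf{E}[\mathrm{OPT}(I)],$$ where $\mathrm{MLS}(I)$ is the total amount of resources allocated by $MLS$ on the sample path $I$. That is, the competitive ratio of $MLS$ is at least $1-\frac1{\sqrt{2\pi d}}+O(1/d)$.
   Context: Model. Write $[k]=\{1,\dots,k\}$. A problem instance consists of a horizon $[0,T]$; $m$ resources, resource $j\in[m]$ having capacity $c_j>0$; $n$ customer types, where customers of type $i\in[n]$ arrive according to a non-homogeneous Poisson process with known rate $\lambda_i(t)$, $t\in[0,T]$, and finite expected number of arrivals $\Lambda_i=\int_0^T\lambda_i(t)\,dt$ (the processes of different types are independent); and known numbers $u_{ij}\in[0,c_j]$. When a customer arrives, it must immediately and irrevocably be assigned to one of the resources or rejected. Assigning a type-$i$ customer to resource $j$ consumes exactly $u_{ij}$ units of resource $j$ (allowed only if at least $u_{ij}$ units of $j$ remain) and earns reward $u_{ij}$. $I$ denotes a sample path of arrivals over the whole horizon, and $\mathrm{OPT}(I)$ is the total amount of resources allocated by an optimal offline algorithm, i.e. one that knows $I$ at time $0$. Expectations are over $I$ and the algorithm's randomness. (LP): maximize $\sum_{i\in[n]}\sum_{j\in[m]}x_{ij}u_{ij}$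 subject to $\sum_{i}x_{ij}u_{ij}\le c_j$ for all $j$, $\sum_j x_{ij}\le\Lambda_i$ for all $i$, and $x_{ij}\ge0$. Algorithm $MLS$ (parameter: integer $d\ge2$ with $u_{ij}\le c_j/d$ for all $i,j$). For each resource $j$ let $L_j=\{i\in[n]:u_{ij}>c_j/(d+1)\}$ and $S_j=\{i\in[n]:u_{ij}\le c_j/(d+1)\}$. (1) Solve (LP) to get an optimal solution $x^*$; set $U_j^L=\sum_{i\in L_j}x^*_{ij}u_{ij}$, $U_j^S=\sum_{i\in S_j}x^*_{ij}u_{ij}$, $U_j=U_j^L+U_j^S$. (2) Reservation: for $X\in\{L,S\}$, with $a^X_j=(d+1)U_j^X/c_j$, compute $$\mathrm{ratio}_j^X=\frac1{d+1}\Big[\sum_{k=1}^d e^{-a_j^X}\frac{(a_j^X)^k}{(k-1)!}+\sum_{k=d+1}^\infty d\,e^{-a_j^X}\frac{(a_j^X)^k}{k!}\Big],$$ $$\mathrm{ratio}_j^{\mathrm{all}}=\frac{U_j}{c_j}\Big(1-e^{-d}\sum_{i=d}^\infty(i-d+1)\frac{d^{i-1}}{i!}\Big).$$ Reserve resource $j$ for the types in $L_j$ if $\mathrm{ratio}_j^L$ is the largest of the three ratios; for the types in $S_j$ if $\mathrm{ratio}_j^S$ is the largest; otherwise open resource $j$ to all types. (3) Random routing: upon arrival of a type-$i$ customer, independently of everything else, pick at random a resource, resource $j$ being picked with probability $x^*_{ij}/\Lambda_i$ (with the remaining probability none is picked and the customer is rejected). (4) Admission: if the remaining capacity of the picked resource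 $j$ is at least $u_{ij}$ and $i$ belongs to the set of types for which $j$ is reserved (all types if $j$ is open to all), assign the customer to $j$; otherwise reject the customer. *)

(* Defs.v *)
From HB Require Import structures.
From mathcomp Require Import all_boot all_order all_algebra.
From mathcomp Require Import all_classical all_reals all_analysis.

Set Implicit Arguments.
Unset Strict Implicit.
Unset Printing Implicit Defensive.

Import Order.TTheory GRing.Theory Num.Theory.
Import numFieldNormedType.Exports.

Local Open Scope classical_set_scope.
Local Open Scope ring_scope.

Record instance (R : realType) (n m : nat) := Instance {
  horizon : R;
  capacity : 'I_m -> R;
  rate : 'I_n -> R -> R;
  usage : 'I_n -> 'I_m -> R }.

Section Model.
Variables (R : realType) (n m : nat) (I : instance R n m).
Local Notation T := (horizon I).
Local Notation c := (capacity I).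
Local Notation u := (usage I).
Local Notation leb := (@lebesgue_measure R).

Definition valid_instance : Prop :=
  [/\ 0 <= T,
      forall j, 0 < c j,
      forall i, (forall t, 0 <= t <= T -> 0 <= rate I i t) /\
                leb.-integrable `[0, T] (EFin \o rate I i) &
      forall i j, 0 <= u i j <= c j].

Definition mean_arrivals (i : 'I_n) : R := \int[leb]_(t in `[0, T]) rate I i t.

Definition lp_feasible (x : 'I_n -> 'I_m -> R) : Prop :=
  [/\ forall j, \sum_i x i j * u i j <= c j,
      forall i, \sum_j x i j <= mean_arrivals i &
      forall i j, 0 <= x i j].

Definition lp_value (x : 'I_n -> 'I_m -> R) : R := \sum_i \sum_j x i j * u i j.

Definition lp_optimal (x : 'I_n -> 'I_m -> R) : Prop :=
  lp_feasible x /\ forall y, lp_feasible y -> lp_value y <= lp_value x.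

(* A sample path lists the arrivals (time, type) in chronological order. *)
Definition sample_path := seq (R * 'I_n).

Definition well_formed_path (p : sample_path) : Prop :=
  sorted (fun a b : R * 'I_n => a.1 <= b.1) p /\
  (forall a, a \in p -> 0 <= a.1 <= T).

Definition arrivals_in (i : 'I_n) (A : set R) (p : sample_path) : nat :=
  count (fun a : R * 'I_n => (a.2 == i) && (a.1 \in A)) p.

(* Since consumed units are never returned, a sequence of assignments is
   admissible at all times iff the total consumption of each resource is at
   most its capacity. [None] stands for rejection. *)
Definition offline_feasible (s : seq 'I_n)
    (f : {ffun 'I_(size s) -> option 'I_m}) : bool :=
  [forall j, \sum_(k | f k == Some j) u (tnth (in_tuple s) k) j <= c j].

Definition offline_value (s : seq 'I_n)
    (f : {ffun 'I_(size s) -> option 'I_m}) : R :=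
  \sum_k (if f k is Some j then u (tnth (in_tuple s) k) j else 0).

(* The default value 0 of the maximum is attained by rejecting everyone. *)
Definition opt_types (s : seq 'I_n) : R :=
  \big[Num.max/0]_(f : {ffun 'I_(size s) -> option 'I_m} | offline_feasible f)
    offline_value f.

Definition OPT (p : sample_path) : R := opt_types (map snd p).

Inductive reservation := ForLarge | ForSmall | OpenToAll.

Section MLS.
Variables (d : nat) (x : 'I_n -> 'I_m -> R).

Definition large (j : 'I_m) : pred 'I_n := fun i => c j / d.+1%:R < u i j.
Definition small (j : 'I_m) : pred 'I_n := fun i => u i j <= c j / d.+1%:R.

Definition U_large (j : 'I_m) : R := \sum_(i | large j i) x i j * u i j.
Definition U_small (j : 'I_m) : R := \sum_(i | small j i) x i j * u i j.
Definition U_all (j : 'I_m) : R := U_large j + U_small j.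

Definition ratio_one_class (j : 'I_m) (U : R) : R :=
  let a := d.+1%:R * U / c j in
  d.+1%:R^-1 *
    (\sum_(1 <= k < d.+1) expR (- a) * a ^+ k / (k.-1)`!%:R
     + limn (fun N => \sum_(d.+1 <= k < N)
               d%:R * expR (- a) * a ^+ k / k`!%:R : R)).

Definition ratio_all (j : 'I_m) : R :=
  U_all j / c j *
    (1 - expR (- d%:R) *
       limn (fun N => \sum_(d <= i < N)
               (i - d + 1)%N%:R * d%:R ^+ i.-1 / i`!%:R : R)).

Definition ratio (j : 'I_m) (r : reservation) : R :=
  match r with
  | ForLarge => ratio_one_class j (U_large j)
  | ForSmall => ratio_one_class j (U_small j)
  | OpenToAll => ratio_all j
  end.

(* Ties between the three ratios may be broken arbitrarily. *)
Definition mls_reservation (rsv : 'I_m -> reservation) : Prop :=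
  forall j r, ratio j r <= ratio j (rsv j).

Definition eligible (r : reservation) (j : 'I_m) : pred 'I_n :=
  match r with
  | ForLarge => large j
  | ForSmall => small j
  | OpenToAll => predT
  end.

(* [rem] is the remaining capacity of each resource; a request is the type of
   the customer together with the picked resource, if any. The result is the
   total amount allocated. *)
Fixpoint admission (rsv : 'I_m -> reservation) (rem : 'I_m -> R)
    (reqs : seq ('I_n * option 'I_m)) : R :=
  if reqs is (i, pick) :: reqs' then
    if pick is Some j then
      if (u i j <= rem j) && eligible (rsv j) j i then
        u i j + admission rsv
                  (fun k => if k == j then rem k - u i j else rem k) reqs'
      else admission rsv rem reqs'
    else admission rsv rem reqs'
  else 0.

End MLS.

(* [picks i q] is the resource picked for the customer of type i that is
   preceded by exactly q customers of type i; [seen] collects the types of the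
   earlier customers. *)
Fixpoint routed (picks : 'I_n -> nat -> option 'I_m) (seen s : seq 'I_n)
    : seq ('I_n * option 'I_m) :=
  if s is i :: s' then
    (i, picks i (count_mem i seen)) :: routed picks (i :: seen) s'
  else [::].

Definition MLS (d : nat) (rsv : 'I_m -> reservation)
    (picks : 'I_n -> nat -> option 'I_m) (p : sample_path) : R :=
  admission d rsv c (routed picks [::] (map snd p)).

End Model.

Section Randomness.
Local Open Scope ereal_scope.
Variables (R : realType) (disp : measure_display) (W : measurableType disp)
  (P : probability W R).

Definition mutually_independent (K : eqType) (F : K -> set (set W)) : Prop :=
  forall (s : seq K) (E : K -> set W), uniq s ->
    (forall k, k \in s -> F k (E k)) ->
    P (\bigcap_(k in [set` s]) E k) = \prod_(k <- s) P (E k).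

Definition events_of (V : Type) (X : W -> V) : set (set W) :=
  preimage_set_system setT X setT.

Variables (n m : nat) (I : instance R n m).
Local Notation T := (horizon I).
Local Notation leb := (@lebesgue_measure R).

Definition arrival_count (path : W -> sample_path R n) (i : 'I_n)
    (A : set R) (w : W) : nat := arrivals_in i A (path w).

(* The second argument of [poisson_prob] is not used by its definition. The
   rate 0 (the Dirac mass at 0) is included. *)
Definition poisson_process (path : W -> sample_path R n) (i : 'I_n) : Prop :=
  (forall A : set R, measurable A -> A `<=` `[0%R, T] ->
     forall B : set nat,
       measurable (arrival_count path i A @^-1` B) /\
       P (arrival_count path i A @^-1` B) =
         poisson_prob (\int[leb]_(t in A) rate I i t)%R 0 B) /\
  (forall A : nat -> set R,
     (forall l, measurable (A l)) -> (forall l, A l `<=` `[0%R, T]) ->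
     trivIset setT A ->
     mutually_independent (fun l => events_of (arrival_count path i (A l)))).

Definition arrival_sigma (path : W -> sample_path R n) (i : 'I_n)
    : set (set W) :=
  <<s \bigcup_(A in [set A : set R | measurable A /\ A `<=` `[0%R, T]])
        events_of (arrival_count path i A) >>.

Definition source (path : W -> sample_path R n)
    (picks : W -> 'I_n -> nat -> option 'I_m) (k : 'I_n + 'I_n * nat)
    : set (set W) :=
  match k with
  | inl i => arrival_sigma path i
  | inr iq => events_of (fun w => picks w iq.1 iq.2)
  end.

(* Where [mean_arrivals I i = 0], feasibility of x forces x i j = 0, and the
   routing probability 0 / 0 evaluates to 0. The event that no resource is
   picked receives the complementary probability. *)
Definition random_routing (x : 'I_n -> 'I_m -> R)
    (picks : W -> 'I_n -> nat -> option 'I_m) : Prop :=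
  forall i q,
    (forall r, measurable [set w | picks w i q = r]) /\
    (forall j, P [set w | picks w i q = Some j] = (x i j / mean_arrivals I i)%:E).

Definition mls_environment (x : 'I_n -> 'I_m -> R)
    (path : W -> sample_path R n)
    (picks : W -> 'I_n -> nat -> option 'I_m) : Prop :=
  [/\ forall w, well_formed_path I (path w),
      forall i, poisson_process path i,
      random_routing x picks &
      mutually_independent (source path picks)].

End Randomness.

(* Main.v *)
Require Import Defs.
From mathcomp Require Import all_boot all_order all_algebra.
From mathcomp Require Import all_classical all_reals all_analysis.
From mathcomp Require Import measurable_realfun ring lra.
Import Order.TTheory GRing.Theory Num.Theory.
Import numFieldNormedType.Exports.
Set Implicit Arguments.
Unset Strict Implicit.
Unset Printing Implicit Defensive.
Local Open Scope classical_set_scope.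
Local Open Scope ring_scope.

(** Why the theorem holds.

    Upper bound. The numbers of customers that an offline solution assigns from
    each type to each resource satisfy the constraints of the linear program with
    the realized numbers of arrivals on the right-hand side. Their expectations
    therefore form a feasible point of the linear program ([expected_best_le]),
    and E[OPT] is at most its value, the sum over the resources j of the load U_j
    that the solution x puts on j.

    Lower bound. After random routing, the numbers of customers of the various
    types that request a fixed resource j are independent Poisson variables with
    means x i j ([integral_thinned]). The amount that j allocates depends on the
    order of the requests, but it is bounded from below by functions of these
    numbers alone. If the eligible requests have size at most kappa and the
    capacity is (K + 1) kappa, then the allocation is at least the minimum of the
    demand and K kappa ([greedy_ge_min]); this covers a resource reserved for small
    types (kappa = c / (d + 1), K = d) and a resource open to all types
    (kappa = c / d, K = d - 1). If the sizes lie between c / (d + 1) and c / d, then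
    the first d requests fit: the allocation is the whole demand when there are at
    most d requests, and at least d c / (d + 1) otherwise ([greedy_ge_large]).

    The expectations of these functions are compared with [pmin K a], the expected
    minimum of K and a Poisson variable of mean a, where a is the load in units of
    kappa. For jumps of size at most 1 this is the convex order between a compound
    Poisson variable and the Poisson variable of the same mean
    ([pmin_le_small_jumps]); for jumps of size at least 1 it follows from
    size-biasing and the tangent of the concave function [pmin d]
    ([pmin_le_large_jumps]). In each mode the expected allocation is thus at least
    the capacity times the corresponding ratio ([ratio_minorant]).

    Conclusion. The mode chosen has the largest ratio, so each resource allocates
    at least capacity times [ratio_all] in expectation, whatever the mode. That is
    U_j times a factor which is computed by size-biasing ([overflow_le]): it is
    1 - e^(-d) d^d / d! up to O(1/d). The lower half of Stirling's formula
    ([poisson_mode_le]), which is derived from Wallis's inequality, finishes the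
    proof with the error term -2/d. *)

(** * Wallis's inequality and Stirling's lower bound *)

Section Stirling.
Variable R : realType.
Implicit Types (x t : R) (n : nat).

(** The antiderivative of the n-th power of the sine that vanishes at 0. It is
    given by the reduction formula instead of an integral, which makes the
    recurrence of the Wallis integrals hold by definition. *)
Fixpoint sin_pow_primitive n x : R :=
  match n with
  | 0 => x
  | 1 => 1 - cos x
  | n'.+2 => (n'.+1%:R * sin_pow_primitive n' x - sin x ^+ n'.+1 * cos x)
               / n'.+2%:R
  end.

Lemma sin_pow_primitive0 n : sin_pow_primitive n 0 = 0.
Proof.
suff: sin_pow_primitive n 0 = 0 /\ sin_pow_primitive n.+1 0 = 0 by case.
elim: n => [|n [IH0 IH1]]; first by rewrite /= cos0 subrr.
by split => //=; rewrite IH0 sin0 expr0n/= mul0r mulr0 subrr mul0r.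
Qed.

Lemma is_derive_sin_pow_primitive n x :
  is_derive x 1 (sin_pow_primitive n) (sin x ^+ n).
Proof.
suff: is_derive x 1 (sin_pow_primitive n) (sin x ^+ n) /\
      is_derive x 1 (sin_pow_primitive n.+1) (sin x ^+ n.+1) by case.
elim: n => [|n [IH0 IH1]].
  split; first by rewrite expr0; exact: is_derive_id.
  have -> : sin_pow_primitive 1 = cst 1 - cos by apply/funext => y.
  by apply: is_derive_eq; rewrite expr1 sub0r opprK.
split; first exact: IH1.
have -> : sin_pow_primitive n.+2 =
   n.+2%:R^-1 *: (n.+1%:R *: sin_pow_primitive n - (sin ^+ n.+1) * cos).
  apply/funext => y /=; rewrite !fctE.
  by rewrite /GRing.scale/= mulrC.
apply: is_derive_eq.
rewrite /GRing.scale/= !fctE.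
have c2 := cos2sin2 x.
rewrite !exprS.
set s := sin x in c2 *; set c := cos x in c2 *; set sn := s ^+ n.
have n0 : n.+2%:R != 0 :> R by rewrite pnatr_eq0.
apply: (mulfI n0); rewrite mulVKf//.
rewrite -[n.+2]addn1 -[n.+1]addn1 !natrD.
have -> : n%:R + 1 = n.+1%:R :> R by rewrite -natr1.
ring: c2.
Qed.

Lemma continuous_sin_pow_primitive n : continuous (sin_pow_primitive n).
Proof.
move=> x; apply: differentiable_continuous; apply/derivable1_diffP.
by have [] := is_derive_sin_pow_primitive n x.
Qed.

Lemma sin_pow_primitive_decr n :
  sin_pow_primitive n.+1 (pi / 2) <= sin_pow_primitive n (pi / 2).
Proof.
have p0 : 0 <= pi / 2 :> R by rewrite divr_ge0 ?pi_ge0.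
pose g : R -> R := sin_pow_primitive n - sin_pow_primitive n.+1.
have dg x : is_derive x 1 g (sin x ^+ n - sin x ^+ n.+1).
  have ? := is_derive_sin_pow_primitive n x.
  have ? := is_derive_sin_pow_primitive n.+1 x.
  exact: is_deriveB.
suff : g 0 <= g (pi / 2).
  by rewrite /g !fctE !sin_pow_primitive0 subrr subr_ge0.
apply: (@ger0_derive1_le_cc R g 0 (pi / 2)) => //.
- move=> x; rewrite in_itv/= => /andP[x0 xp].
  rewrite derive1E (@derive_val _ _ _ _ _ _ _ (dg x)).
  rewrite exprS -{1}[sin x ^+ n]mul1r -mulrBl mulr_ge0 ?subr_ge0 ?sin_le1//.
  by rewrite exprn_ge0// ltW// sin_gt0_pihalf// x0.
- apply: continuous_subspaceT => x.
  by apply: continuousB; exact: continuous_sin_pow_primitive.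
- by rewrite in_itv/= lexx.
- by rewrite in_itv/= p0 lexx.
Qed.

Lemma sin_pow_primitiveSS n :
  n.+2%:R * sin_pow_primitive n.+2 (pi / 2) =
  n.+1%:R * sin_pow_primitive n (pi / 2).
Proof.
by rewrite /= cos_pihalf mulr0 subr0 mulrC divfK.
Qed.

Lemma sin_pow_primitive_mulS n :
  n.+1%:R * sin_pow_primitive n (pi / 2) * sin_pow_primitive n.+1 (pi / 2)
  = pi / 2.
Proof.
elim: n => [|n IH]; first by rewrite mul1r /= cos_pihalf subr0 mulr1.
by rewrite mulrAC sin_pow_primitiveSS.
Qed.

Lemma sin_pow_primitive_even n :
  sin_pow_primitive n.*2 (pi / 2) =
  (n.*2)`!%:R / (4 ^+ n * n`!%:R ^+ 2) * (pi / 2).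
Proof.
elim: n => [|n IH]; first by rewrite /= fact0 expr0 expr1n mul1r divr1 mul1r.
have n0 : n.*2.+2%:R != 0 :> R by rewrite pnatr_eq0.
rewrite doubleS; apply: (mulfI n0); rewrite sin_pow_primitiveSS IH.
rewrite !factS !natrM [4 ^+ n.+1]exprS.
have f0 : n`!%:R != 0 :> R by rewrite pnatr_eq0 -lt0n fact_gt0.
have p0 : 4 ^+ n != 0 :> R by rewrite expf_neq0.
have n1 : n.+1%:R != 0 :> R by rewrite pnatr_eq0.
have -> : n.*2.+2%:R = 2 * n.+1%:R :> R by rewrite -natrM mul2n doubleS.
field.
by rewrite f0 p0 nat1r n1.
Qed.

(** Wallis's inequality: the integrals of the powers of the sine decrease, and
    the product of two consecutive ones is explicit, so the square of an even one
    is bounded by its product with the odd one before it. *)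
Lemma central_binomial_sqr_le n : (0 < n)%N ->
  ((n.*2)`!%:R / (4 ^+ n * n`!%:R ^+ 2)) ^+ 2 * (pi * n%:R) <= 1 :> R.
Proof.
case: n => // n _.
set q := _ / _.
have pi0 := pi_gt0 R.
have q0 : 0 <= q by rewrite divr_ge0// mulr_ge0// exprn_ge0.
have E := sin_pow_primitive_mulS n.*2.+1.
have D := sin_pow_primitive_decr n.*2.+1.
rewrite -doubleS sin_pow_primitive_even -/q in E D.
have : n.+1.*2%:R * (q * (pi / 2)) * (q * (pi / 2)) <= pi / 2.
  rewrite -[leRHS]E ler_wpM2r//; first by rewrite !mulr_ge0 ?invr_ge0// ltW.
  by rewrite ler_wpM2l.
rewrite -mul2n natrM.
have -> : 2 * n.+1%:R * (q * (pi / 2)) * (q * (pi / 2)) =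
  (q ^+ 2 * (pi * n.+1%:R)) * (pi / 2) by field.
by rewrite ger_pMl// divr_gt0.
Qed.

(** At t = ln y this is the trapezoidal bound ln y <= (y - 1/y) / 2, sharp enough
    for the sum of its errors over y = (n + 1) / n to telescope. *)
Lemma ler_sinh t : 0 <= t -> t *+ 2 <= expR t - expR (- t).
Proof.
move=> t0.
pose g : R -> R := expR - (expR \o -%R) - (2 *: id).
have dg x : is_derive x 1 g (expR x + expR (- x) - 2).
  rewrite /g; apply: is_derive_eq.
  by rewrite /GRing.scale/= mulrN1 opprK mulr1.
suff : g 0 <= g t.
  rewrite /g !fctE /= oppr0 subrr /GRing.scale/= mulr0 subr0 subr_ge0.
  by rewrite mulr_natl.
apply: (@ger0_derive1_le_cc R g 0 t) => //.
- move=> x; rewrite in_itv/= => /andP[x0 xp].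
  rewrite derive1E (@derive_val _ _ _ _ _ _ _ (dg x)).
  by have := expR_ge1Dx x; have := expR_ge1Dx (- x); lra.
- apply: continuous_subspaceT => x.
  apply: differentiable_continuous; apply/derivable1_diffP.
  by have [] := dg x.
- by rewrite in_itv/= lexx.
- by rewrite in_itv/= t0 lexx.
Qed.

(** The square of n! / (sqrt n (n/e)^n); Stirling's formula says that it tends to
    2 pi. *)
Definition stirling_sqr n : R :=
  n`!%:R ^+ 2 * expR n%:R ^+ 2 / n%:R ^+ n.*2.+1.

Lemma stirling_sqr_gt0 n : (0 < n)%N -> 0 < stirling_sqr n.
Proof.
move=> n0; rewrite divr_gt0// ?mulr_gt0// ?exprn_gt0// ?expR_gt0//.
by rewrite ltr0n.
Qed.

(** The quotient of two consecutive terms is (1 + 1/n)^(2n + 1) / e^2. *)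
Lemma stirling_sqr_le_succ n : (0 < n)%N ->
  stirling_sqr n <=
  stirling_sqr n.+1 * expR ((n%:R^-1 - n.+1%:R^-1) / 2).
Proof.
move=> n0.
have n0' : 0 < n%:R :> R by rewrite ltr0n.
have n1' : 0 < n.+1%:R :> R by rewrite ltr0n.
have nE : n.+1%:R = n%:R + 1 :> R by rewrite -natr1.
pose y : R := n.+1%:R / n%:R.
have y0 : 0 < y by rewrite divr_gt0.
have y1 : 1 <= y by rewrite ler_pdivlMr// mul1r ler_nat.
have lny : ln y * n.*2.+1%:R <= 2 + (n%:R^-1 - n.+1%:R^-1) / 2.
  have := ler_sinh (ln_ge0 y1).
  rewrite expRN lnK ?posrE// => H.
  have -> : 2 + (n%:R^-1 - n.+1%:R^-1) / 2 = (y - y^-1) / 2 * n.*2.+1%:R.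
    have -> : n.*2.+1%:R = 2 * n%:R + 1 :> R by rewrite -natr1 -mul2n natrM.
    rewrite /y invf_div nE.
    by field; rewrite -nE !gt_eqF.
  rewrite ler_wpM2r//; rewrite ler_pdivlMr//.
  by rewrite -mulr_natr in H.
have -> : stirling_sqr n =
    stirling_sqr n.+1 * (y ^+ n.*2.+1 / expR 1 ^+ 2).
  rewrite /stirling_sqr factS natrM /y -[in expR n.+1%:R]natr1 expRD.
  rewrite doubleS expr_div_n !exprS.
  have : expR 1 != 0 :> R by rewrite expR_eq0.
  have : n%:R ^+ n.*2 != 0 :> R by rewrite expf_neq0// gt_eqF.
  have : n.+1%:R ^+ n.*2 != 0 :> R by rewrite expf_neq0// gt_eqF.
  move=> ? ? ?; field.
  by rewrite nat1r; apply/and5P; split=> //; rewrite gt_eqF.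
rewrite ler_wpM2l//; first by rewrite ltW// stirling_sqr_gt0.
rewrite ler_pdivrMr ?exprn_gt0 ?expR_gt0//.
rewrite -[y in y ^+ _]lnK ?posrE// -!expRM_natr -expRD ler_expR mul1r.
by rewrite addrC.
Qed.

Lemma stirling_sqr_le_add n k : (0 < n)%N ->
  stirling_sqr n <=
  stirling_sqr (n + k) * expR ((n%:R^-1 - (n + k)%:R^-1) / 2).
Proof.
move=> n0; elim: k => [|k IH]; first by rewrite addn0 subrr mul0r expR0 mulr1.
apply: (le_trans IH).
have nk : (0 < n + k)%N by rewrite ltn_addr.
apply: le_trans (ler_wpM2r _ (stirling_sqr_le_succ nk)) _; first exact: expR_ge0.
rewrite addnS -mulrA -expRD -mulrDl addrC addrA subrK.
by rewrite ler_wpM2l// ltW// stirling_sqr_gt0.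
Qed.

(** The factorials combine into the square of a central binomial coefficient, to
    which Wallis's inequality applies. *)
Lemma stirling_sqr_double n : (0 < n)%N ->
  stirling_sqr n.*2 * (2 * pi) <= stirling_sqr n ^+ 2.
Proof.
move=> n0.
have n0' : 0 < n%:R :> R by rewrite ltr0n.
have := central_binomial_sqr_le n0; set q := _ / _ => W.
have -> : stirling_sqr n.*2 = stirling_sqr n ^+ 2 * (q ^+ 2 * n%:R / 2).
  rewrite /stirling_sqr /q.
  have -> : expR n.*2%:R = expR n%:R ^+ 2 :> R.
    by rewrite -mul2n natrM -expRM_natl.
  have -> : n.*2%:R ^+ n.*2.*2.+1 =
     2 * n%:R * (4 ^+ n) ^+ 2 * (n%:R ^+ n.*2) ^+ 2 :> R.
    rewrite exprS -[n.*2.*2]muln2 exprM -!mul2n natrM !exprMn.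
    have -> : (2 : R) ^+ (2 * n) = 4 ^+ n by rewrite exprM; congr (_ ^+ _); ring.
    by ring.
  have -> : n%:R ^+ n.*2.+1 = n%:R * n%:R ^+ n.*2 :> R by rewrite exprS.
  have : expR n%:R != 0 :> R by rewrite expR_eq0.
  have : n%:R ^+ n.*2 != 0 :> R by rewrite expf_neq0// gt_eqF.
  have : n`!%:R != 0 :> R by rewrite pnatr_eq0 -lt0n fact_gt0.
  have : (4 : R) ^+ n != 0 by rewrite expf_neq0.
  move=> ? ? ? ?; field.
  by apply/and4P; split; rewrite // gt_eqF.
rewrite -mulrA ger_pMr ?exprn_gt0 ?stirling_sqr_gt0//.
by apply: le_trans W; rewrite le_eqVlt; apply/orP; left; apply/eqP; field.
Qed.

(** The value at n is, up to the factor exp(1/(4n)), at most the value at 2n,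
    which is at most the square of the value at n divided by 2 pi. *)
Lemma stirling_sqr_ge n : (0 < n)%N ->
  2 * pi <= stirling_sqr n * expR (n%:R^-1 / 4).
Proof.
move=> n0.
have b0 := stirling_sqr_gt0 n0.
rewrite -(ler_pM2l b0) [leRHS]mulrA -expr2.
have D := stirling_sqr_double n0.
apply: le_trans (ler_wpM2r (expR_ge0 _) D).
rewrite [leRHS]mulrAC ler_wpM2r ?mulr_ge0 ?pi_ge0//.
have := stirling_sqr_le_add n n0; rewrite addnn.
have -> // : (n%:R^-1 - n.*2%:R^-1) / 2 = n%:R^-1 / 4 :> R.
by rewrite -mul2n natrM; field; rewrite pnatr_eq0 -lt0n.
Qed.

(** Stirling's lower bound for d!; its relative error exp(1/(8d)) is absorbed by
    the term 1/d. *)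
Lemma poisson_mode_le (d : nat) : (0 < d)%N ->
  expR (- d%:R) * d%:R ^+ d / d`!%:R <=
  (Num.sqrt (2 * pi * d%:R))^-1 + d%:R^-1 :> R.
Proof.
move=> d0.
have d0' : 0 < d%:R :> R by rewrite ltr0n.
have d1' : 1 <= d%:R :> R by rewrite ler1n.
have pi0 := pi_gt0 R.
set p := leLHS; set s := Num.sqrt _.
have x0 : 0 < 2 * pi * d%:R :> R by rewrite !mulr_gt0.
have s0 : 0 < s by rewrite sqrtr_gt0.
have sE : s ^+ 2 = 2 * pi * d%:R by rewrite sqr_sqrtr// ltW.
have b0 := stirling_sqr_gt0 d0.
have pE : p ^+ 2 = (d%:R * stirling_sqr d)^-1.
  have -> : stirling_sqr d =
      d`!%:R ^+ 2 * expR d%:R ^+ 2 / (d%:R * (d%:R ^+ d) ^+ 2).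
    by rewrite /stirling_sqr [_ ^+ d.*2.+1]exprS -muln2 exprM.
  rewrite /p expRN.
  have : expR d%:R != 0 :> R by rewrite expR_eq0.
  have : d%:R ^+ d != 0 :> R by rewrite expf_neq0// gt_eqF.
  have : d`!%:R != 0 :> R by rewrite pnatr_eq0 -lt0n fact_gt0.
  by move=> ? ? ?; field; apply/and4P; split=> //; rewrite gt_eqF.
have p2 : p ^+ 2 <= (s ^+ 2)^-1 * expR (d%:R^-1 / 4).
  rewrite pE sE -lef_pV2 ?posrE; last 2 first.
  - by rewrite mulr_gt0 ?expR_gt0 ?invr_gt0.
  - by rewrite invr_gt0 mulr_gt0.
  rewrite invrK invfM invrK -expRN.
  rewrite mulrAC mulrC ler_pM2l//.
  by rewrite expRN ler_pdivrMr ?expR_gt0// stirling_sqr_ge.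
have e1 : expR (d%:R^-1 / 4) <= 1 + d%:R^-1 :> R.
  set z := d%:R^-1.
  have z0 : 0 < z by rewrite invr_gt0.
  have z1 : z <= 1 by rewrite invf_le1.
  have := expR_ge1Dx (- (z / 4)); rewrite expRN => H.
  rewrite -[expR _]invrK -[1 + z]invrK lef_pV2 ?posrE ?invr_gt0 ?expR_gt0//.
    apply: le_trans H; rewrite -div1r ler_pdivrMr; nra.
  lra.
have s1 : 1 <= s.
  rewrite -sqrtr1 ler_wsqrtr//; have := pi_ge2 R; nra.
rewrite -(@ler_pXn2r _ 2) ?nnegrE//; last 2 first.
- by rewrite /p !mulr_ge0 ?expR_ge0 ?exprn_ge0.
- by rewrite addr_ge0 ?invr_ge0 // ltW.
apply: (le_trans p2).
have v0 : 0 < s^-1 by rewrite invr_gt0.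
have v1 : s^-1 <= 1 by rewrite invf_le1.
rewrite -exprVn.
move: e1; set e := expR _; set z := d%:R^-1; set v := s^-1 in v0 v1 *.
have z0 : 0 < z by rewrite invr_gt0.
move=> e1; apply: le_trans (ler_wpM2l (sqr_ge0 v) e1) _.
have : v ^+ 2 * z <= v * z.
  by rewrite ler_wpM2r ?(ltW z0)// expr2 ler_piMl// ltW.
have := mulr_ge0 (ltW v0) (ltW z0); have := sqr_ge0 z.
rewrite sqrrD mulrDr mulr1 -mulr_natl; lra.
Qed.

End Stirling.

(** * Poisson expectations *)

Section Poisson.
Variable R : realType.
Implicit Types (a b x y r : R) (k l n : nat).
Local Open Scope ereal_scope.

(** Unlike [poisson_pmf], this is the right mass at parameter 0 as well. *)
Definition pois a k : R := (expR (- a) * a ^+ k / k`!%:R)%R.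

Definition pexp a (f : nat -> \bar R) : \bar R :=
  \sum_(k <oo) (pois a k)%:E * f k.

Lemma pois_ge0 a k : (0 <= a)%R -> (0 <= pois a k)%R.
Proof. by move=> a0; rewrite /pois !mulr_ge0 ?expR_ge0 ?exprn_ge0. Qed.

Lemma pois0 k : pois 0 k = (k == 0%N)%:R.
Proof.
rewrite /pois oppr0 expR0 mul1r expr0n.
by case: k => [|k]; rewrite ?fact0 ?divr1// mul0r.
Qed.

Lemma poisSM a k : (pois a k.+1 * k.+1%:R = a * pois a k)%R.
Proof.
rewrite /pois factS natrM exprS.
have f0 : (k`!%:R != 0 :> R)%R by rewrite pnatr_eq0 -lt0n fact_gt0.
have k0 : (k.+1%:R != 0 :> R)%R by rewrite pnatr_eq0.
by field; rewrite f0 nat1r.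
Qed.

Lemma poisD a b n :
  pois (a + b) n = (\sum_(k < n.+1) pois a k * pois b (n - k)%N)%R.
Proof.
rewrite /pois opprD expRD (addrC a b) exprDn mulr_sumr mulr_suml; apply: eq_bigr => k _.
have kn : (k <= n)%N by rewrite -ltnS.
rewrite -mulr_natr.
have /(congr1 (fun z => z%:R : R)%R) := bin_fact kn; rewrite !natrM => <-.
have f0 m : (m`!%:R != 0 :> R)%R by rewrite pnatr_eq0 -lt0n fact_gt0.
have c0 : ('C(n, k)%:R != 0 :> R)%R by rewrite pnatr_eq0 -lt0n bin_gt0.
by field; rewrite !f0 c0.
Qed.

Lemma poisson_pmfE a k : (0 < a)%R -> poisson_pmf a k = pois a k.
Proof. by move=> a0; rewrite /poisson_pmf a0 /pois; ring. Qed.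

Lemma sum_pois a : (0 <= a)%R -> \sum_(k <oo) (pois a k)%:E = 1.
Proof.
rewrite le_eqVlt => /predU1P[<-|a0].
  rewrite (@nneseriesD1 _ _ 0%N)//; last by move=> k _; rewrite lee_fin pois_ge0.
  rewrite pois0 eseries_cond eseries0 ?adde0// => k _ /andP[k0 _].
  by rewrite pois0 (negbTE k0).
have := probability_setT (poisson_prob a 0); rewrite /= /poisson_prob a0 => <-.
rewrite -nneseries_esumT; last by move=> k; rewrite lee_fin poisson_pmf_ge0.
by apply: eq_eseriesr => k _; rewrite poisson_pmfE.
Qed.

Lemma poisson_probE a n k : (0 <= a)%R ->
  poisson_prob a n [set k] = (pois a k)%:E.
Proof.
move=> a0; rewrite /poisson_prob; case: ifPn => [a1|].
  by rewrite esum_set1 ?lee_fin ?poisson_pmf_ge0// poisson_pmfE.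
rewrite -leNgt => a1; have -> : a = 0%R by apply/le_anti; rewrite a1.
rewrite pois0 diracE; congr (_%:R%:E); congr nat_of_bool.
by apply/idP/idP => [|/eqP->]; rewrite inE// => ->.
Qed.

Lemma nneseries_cauchy (g : nat -> nat -> \bar R) : (forall k l, 0 <= g k l) ->
  \sum_(k <oo) \sum_(l <oo) g k l =
  \sum_(n <oo) \sum_(k < n.+1) g k (n - k)%N.
Proof.
move=> g0.
transitivity (\sum_(k <oo) \sum_(n <oo) if (k <= n)%N then g k (n - k)%N else 0).
  apply: eq_eseriesr => k _.
  rewrite [RHS](nneseries_split 0%N k); last by move=> n _; case: ifP.
  rewrite add0n big_nat big1 ?add0e; last first.
    by move=> n /andP[_ nk]; rewrite leqNgt nk.
  rewrite -[RHS]nneseries_addn; last by move=> n; case: ifP.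
  by apply: eq_eseriesr => n _; rewrite leq_addl addnK.
rewrite nneseries_interchange; last by move=> k n; case: ifP.
apply: eq_eseriesr => n _.
rewrite (nneseries_split 0%N n.+1); last by move=> k _; case: ifP.
rewrite add0n eseries0 ?adde0; last first.
  by move=> k nk _; rewrite leqNgt nk.
rewrite big_mkord; apply: eq_bigr => k _.
by rewrite -ltnS ltn_ord.
Qed.

Section PexpTheory.
Variable a : R.
Hypothesis a0 : (0 <= a)%R.
Implicit Types f g : nat -> \bar R.

Let p0 k : 0 <= (pois a k)%:E.
Proof. by rewrite lee_fin pois_ge0. Qed.

Lemma pexp_ge0 f : (forall k, 0 <= f k) -> 0 <= pexp a f.
Proof. by move=> f0; apply: nneseries_ge0 => k _ _; rewrite mule_ge0. Qed.

Lemma eq_pexp f g : f =1 g -> pexp a f = pexp a g.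
Proof. by move=> /funext->. Qed.

Lemma le_pexp f g : (forall k, 0 <= f k) -> (forall k, f k <= g k) ->
  pexp a f <= pexp a g.
Proof.
move=> f0 fg; apply: lee_nneseries => k _; first by rewrite mule_ge0.
by rewrite lee_wpmul2l.
Qed.

Lemma pexpD f g : (forall k, 0 <= f k) -> (forall k, 0 <= g k) ->
  pexp a (fun k => f k + g k) = pexp a f + pexp a g.
Proof.
move=> f0 g0; rewrite -nneseriesD; last 2 first.
- by move=> k _ _; rewrite mule_ge0.
- by move=> k _ _; rewrite mule_ge0.
by apply: eq_eseriesr => k _; rewrite ge0_muleDr.
Qed.

Lemma pexpZ c f : (forall k, 0 <= f k) ->
  pexp a (fun k => c%:E * f k) = c%:E * pexp a f.
Proof.
move=> f0; rewrite -nneseriesZl => [|k _]; last by rewrite mule_ge0.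
by apply: eq_eseriesr => k _; rewrite muleCA.
Qed.

Lemma pexp_cst c : pexp a (fun=> c%:E) = c%:E.
Proof.
rewrite -[RHS]mule1 -(sum_pois a0) -nneseriesZl//.
by apply: eq_eseriesr => k _; rewrite muleC.
Qed.

(** The size-bias identity, from k a^k / k! = a a^(k-1) / (k-1)!. *)
Lemma pexp_natM f : (forall k, 0 <= f k) ->
  pexp a (fun k => k%:R%:E * f k) = a%:E * pexp a (fun k => f k.+1).
Proof.
move=> f0; rewrite -nneseriesZl => [|k _]; last by rewrite mule_ge0.
rewrite /pexp nneseries_recl//; last first.
  by move=> k _; rewrite !mule_ge0// lee_fin.
rewrite mul0e mule0 add0e -nneseries_addn; last first.
  by move=> k; rewrite !mule_ge0// lee_fin.
apply: eq_eseriesr => k _.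
by rewrite addn1 !muleA -!EFinM poisSM.
Qed.

Lemma pexp_nat : pexp a (fun k => k%:R%:E) = a%:E.
Proof.
have := @pexp_natM (fun=> 1) (fun=> lee01).
rewrite pexp_cst mule1 => <-; apply: eq_pexp => k; by rewrite mule1.
Qed.

End PexpTheory.

Lemma pexp0 (f : nat -> \bar R) : (forall k, 0 <= f k) -> pexp 0 f = f 0%N.
Proof.
move=> f0; rewrite /pexp nneseries_recl//; last first.
  by move=> k _; rewrite mule_ge0// lee_fin pois_ge0.
rewrite pois0 mul1e -nneseries_addn; last first.
  by move=> k; rewrite mule_ge0// lee_fin pois_ge0.
by rewrite eseries0 ?adde0// => k _ _; rewrite pois0 addn1 mul0e.
Qed.

Section TwoParameters.
Variables a b : R.
Hypotheses (a0 : (0 <= a)%R) (b0 : (0 <= b)%R).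

Lemma pexp_pexpE (g : nat -> nat -> \bar R) : (forall k l, 0 <= g k l) ->
  pexp a (fun k => pexp b (g k)) =
  \sum_(k <oo) \sum_(l <oo) (pois a k)%:E * ((pois b l)%:E * g k l).
Proof.
move=> g0; apply: eq_eseriesr => k _; rewrite nneseriesZl// => l _.
by rewrite mule_ge0// lee_fin pois_ge0.
Qed.

Lemma pexp_interchange (g : nat -> nat -> \bar R) : (forall k l, 0 <= g k l) ->
  pexp a (fun k => pexp b (g k)) = pexp b (fun l => pexp a (g ^~ l)).
Proof.
move=> g0; rewrite pexp_pexpE//.
have pa k : 0 <= (pois a k)%:E by rewrite lee_fin pois_ge0.
have pb k : 0 <= (pois b k)%:E by rewrite lee_fin pois_ge0.
rewrite nneseries_interchange; last by move=> i j; rewrite !mule_ge0.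
apply: eq_eseriesr => l _; rewrite -nneseriesZl => [|k _]; last first.
  by rewrite mule_ge0.
by apply: eq_eseriesr => k _; rewrite muleCA.
Qed.

(** Superposition of independent Poisson variables: the antidiagonal sums of the
    product of the two laws are binomial expansions. *)
Lemma pexp_add (f : nat -> \bar R) : (forall k, 0 <= f k) ->
  pexp a (fun k => pexp b (fun l => f (k + l)%N)) = pexp (a + b) f.
Proof.
move=> f0; rewrite (pexp_pexpE (fun k l => f0 (k + l)%N)).
have pa k : 0 <= (pois a k)%:E by rewrite lee_fin pois_ge0.
have pb k : 0 <= (pois b k)%:E by rewrite lee_fin pois_ge0.
rewrite nneseries_cauchy; last by move=> i j; rewrite !mule_ge0.
apply: eq_eseriesr => n _; rewrite poisD -sumEFin ge0_sume_distrl; last first.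
  by move=> k _; rewrite EFinM mule_ge0.
apply: eq_bigr => k _.
by rewrite muleA -EFinM subnKC// -ltnS ltn_ord.
Qed.

End TwoParameters.

(** * Binomial thinning *)

(** The expectation of f at a binomial variable with parameters l and r. The
    recursion conditions on one trial, so that it can be matched with trials that
    are revealed one at a time; [bexpE] recovers the usual masses. *)
Fixpoint bexp r l (f : nat -> R) : R :=
  if l is l'.+1 then
    (r * bexp r l' (fun k => f k.+1) + (1 - r) * bexp r l' f)%R
  else f 0%N.

Lemma bexpE r l f : (bexp r l f =
  \sum_(k < l.+1) 'C(l, k)%:R * r ^+ k * (1 - r) ^+ (l - k) * f k)%R.
Proof.
elim: l f => [|l IH] f.
  by rewrite big_ord1 /= bin0 !expr0 !mul1r.
rewrite /= !IH !mulr_sumr [RHS]big_ord_recl/= bin0 expr0 mulr1 mul1r.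
under [X in (_ = _ + X)%R]eq_bigr do
  rewrite /bump /= add1n binS natrD !mulrDl subSS.
rewrite big_split/= addrA [RHS]addrC.
congr (_ + _)%R; first by apply: eq_bigr => k _; rewrite exprS; ring.
rewrite [LHS]big_ord_recl/= bin0 expr0 !subn0 [in RHS]exprS.
congr (_ + _)%R; first by ring.
rewrite [RHS]big_ord_recr/= bin_small// !mul0r addr0.
apply: eq_bigr => k _; rewrite /bump/= add1n.
have -> : (l - k = (l - k.+1).+1)%N by rewrite subnSK.
by rewrite [((1 - r) ^+ _.+1)%R]exprS; ring.
Qed.

Lemma bexp_le r l f g : (0 <= r <= 1)%R ->
  (forall k, (k <= l)%N -> (f k <= g k)%R) -> (bexp r l f <= bexp r l g)%R.
Proof.
move=> /andP[r0 r1]; elim: l f g => [|l IH] f g fg; first exact: fg.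
rewrite /= lerD// ler_wpM2l ?subr_ge0// IH// => k kl; apply: fg => //.
exact: leqW.
Qed.

Lemma bexp_ge0 r l f : (0 <= r <= 1)%R -> (forall k, (0 <= f k)%R) ->
  (0 <= bexp r l f)%R.
Proof.
move=> /andP[r0 r1]; elim: l f => [|l IH] f f0 //=.
by rewrite addr_ge0// mulr_ge0 ?subr_ge0// IH.
Qed.

Lemma bexp_affine r l c y : bexp r l (fun k => y + c * k%:R)%R =
  (y + c * (r * l%:R))%R.
Proof.
elim: l y => [|l IH] y /=; first by rewrite !mulr0.
have -> : (fun k => y + c * k.+1%:R)%R = (fun k => (y + c) + c * k%:R)%R.
  by apply/funext => k; rewrite -natr1; ring.
by rewrite !IH -natr1; ring.
Qed.

(** The numbers of points kept and discarded, each point being kept with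
    probability r, are independent Poisson variables; the sum over the number of
    discarded points is then 1. *)
Lemma pexp_thin a r (f : nat -> R) : (0 <= a)%R -> (0 <= r <= 1)%R ->
  (forall k, (0 <= f k)%R) ->
  pexp a (fun l => (bexp r l f)%:E) = pexp (r * a) (fun k => (f k)%:E).
Proof.
move=> a0 /andP[r0 r1] f0.
have ra0 : (0 <= r * a)%R by rewrite mulr_ge0.
have sa0 : (0 <= (1 - r) * a)%R by rewrite mulr_ge0// subr_ge0.
transitivity (pexp (r * a) (fun k => pexp ((1 - r) * a) (fun=> (f k)%:E))).
  rewrite [RHS]pexp_pexpE//; last by move=> k _; rewrite lee_fin.
  rewrite nneseries_cauchy; last first.
    by move=> i j; rewrite !mule_ge0// lee_fin ?pois_ge0.
  apply: eq_eseriesr => l _; rewrite bexpE -sumEFin ge0_sume_distrr; last first.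
    move=> k _.
    by rewrite lee_fin !mulr_ge0 ?exprn_ge0 ?subr_ge0.
  apply: eq_bigr => k _.
  have kl : (k <= l)%N by rewrite -ltnS.
  rewrite -!EFinM; congr EFin; rewrite /pois.
  have -> : expR (- a) = (expR (- (r * a)) * expR (- ((1 - r) * a)))%R :> R.
    by rewrite -expRD; congr expR; ring.
  have -> : (a ^+ l = a ^+ k * a ^+ (l - k))%R by rewrite -exprD subnKC.
  have /(congr1 (fun z => z%:R : R)%R) := bin_fact kl; rewrite !natrM => <-.
  rewrite !exprMn.
  have g0 m : (m`!%:R != 0 :> R)%R by rewrite pnatr_eq0 -lt0n fact_gt0.
  have c0 : ('C(l, k)%:R != 0 :> R)%R by rewrite pnatr_eq0 -lt0n bin_gt0.
  by field; rewrite !g0 c0.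
by apply: eq_pexp => k; rewrite pexp_cst.
Qed.

(** The expected number of customers served by K slots that receive a
    Poisson(a) number of customers. *)
Definition pmin (K a : R) : \bar R := pexp a (fun k => (Num.min k%:R K)%:E).

(** A jump of size r is less variable than a unit jump taken with probability r.
    After thinning, Jensen's inequality is immediate here because the function is
    the minimum of two affine ones. *)
Lemma pexp_jump_le a r y K : (0 <= a)%R -> (0 <= r <= 1)%R -> (0 <= y)%R ->
  (0 <= K)%R ->
  pexp (r * a) (fun k => (Num.min (y + k%:R) K)%:E) <=
  pexp a (fun k => (Num.min (y + r * k%:R) K)%:E).
Proof.
move=> a0 r01 y0 K0.
have m0 k : (0 <= Num.min (y + k%:R) K)%R by rewrite le_min addr_ge0.
rewrite -pexp_thin//; apply: le_pexp => // l.
  by rewrite lee_fin bexp_ge0.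
rewrite lee_fin le_min; apply/andP; split.
- have := bexp_affine r l 1 y; rewrite mul1r => <-.
  by apply: bexp_le => // k _; rewrite mul1r ge_min lexx.
- apply: (@le_trans _ _ (bexp r l (fun k => K + 0 * k%:R)%R)); last first.
    by rewrite bexp_affine mul0r addr0.
  by apply: bexp_le => // k _; rewrite mul0r addr0 ge_min lexx orbT.
Qed.

(** This is concavity of [pmin K] together with its vanishing at 0. By thinning
    it is enough that b customers kept out of l fill at least b min(l, K) / l of
    the K slots. *)
Lemma pmin_scale K a r : (0 <= a)%R -> (0 <= r <= 1)%R -> (0 <= K)%R ->
  r%:E * pmin K a <= pmin K (r * a).
Proof.
move=> a0 r01 K0; have /andP[r0 r1] := r01.
have m0 (k : nat) : (0 <= Num.min k%:R K)%R by rewrite le_min K0 andbT.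
rewrite /pmin -pexpZ//.
rewrite -pexp_thin//; apply: le_pexp => // l.
  by rewrite -EFinM lee_fin mulr_ge0.
rewrite -EFinM lee_fin.
have [->|l0] := eqVneq l 0%N; first by rewrite /= minEle K0 mulr0.
have l0' : (0 < l%:R :> R)%R by rewrite ltr0n lt0n.
have := bexp_affine r l (Num.min l%:R K / l%:R) 0.
rewrite add0r mulrCA divfK ?gt_eqF// => <-.
apply: bexp_le => // k kl.
rewrite add0r mulrAC ler_pdivrMr//.
have kl' : (k%:R <= l%:R :> R)%R by rewrite ler_nat.
have k0' : (0 <= k%:R :> R)%R by [].
rewrite /Num.min; case: ifPn; case: ifPn; rewrite -?leNgt => *; nra.
Qed.

End Poisson.

(** * Independent Poisson variables *)

Section PoissonFamily.
Variable R : realType.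
Implicit Types (a x y r K : R) (k d : nat) (ps : seq (R * R)).
Local Open Scope ereal_scope.

(** The expectation of G at the list of values of independent Poisson variables
    with parameters xs. *)
Fixpoint iter_pexp (xs : seq R) (G : seq nat -> \bar R) : \bar R :=
  if xs is x :: xs' then pexp x (fun k => iter_pexp xs' (fun ks => G (k :: ks)))
  else G [::].

Fixpoint weighted_sum (rs : seq R) (ks : seq nat) : R :=
  (match rs, ks with
  | r :: rs', k :: ks' => r * k%:R + weighted_sum rs' ks'
  | _, _ => 0
  end)%R.

Lemma iter_pexp_ge0 (xs : seq R) G : (forall x, x \in xs -> (0 <= x)%R) ->
  (forall ks, 0 <= G ks) -> 0 <= iter_pexp xs G.
Proof.
elim: xs G => [|x xs IH] G xs0 G0 //=.
apply: pexp_ge0 => [|k]; first by rewrite xs0// mem_head.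
by apply: IH => // x' x'xs; rewrite xs0// in_cons x'xs orbT.
Qed.

(** A compound Poisson variable whose jumps have sizes r in [0, 1] is less
    variable than the Poisson variable of the same mean: the types of jumps are
    replaced one after the other by unit jumps, while y stands for the jumps of
    the other types. *)
Lemma pmin_le_small_jumps ps y K :
  (forall p, p \in ps -> (0 <= p.1)%R /\ (0 <= p.2 <= 1)%R) ->
  (0 <= y)%R -> (0 <= K)%R ->
  pexp (\sum_(p <- ps) p.2 * p.1)%R (fun k => (Num.min (y + k%:R) K)%:E) <=
  iter_pexp (unzip1 ps)
    (fun ks => (Num.min (y + weighted_sum (unzip2 ps) ks) K)%:E).
Proof.
move=> + + K0; elim: ps y => [|[x r] ps IH] y ps0 y0.
  rewrite big_nil pexp0/=; last by move=> k; rewrite lee_fin le_min addr_ge0.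
  by rewrite !addr0.
have [/= x0 r01] := ps0 _ (mem_head _ _).
have {}ps0 p : p \in ps -> (0 <= p.1)%R /\ (0 <= p.2 <= 1)%R.
  by move=> pps; apply: ps0; rewrite in_cons pps orbT.
have /andP[r0 r1] := r01.
rewrite big_cons /=; set s := (\sum_(p <- ps) _)%R.
have s0 : (0 <= s)%R.
  rewrite /s big_seq sumr_ge0// => p /ps0[p0 /andP[p0' _]].
  by rewrite mulr_ge0.
have m0 z (k : nat) : (0 <= z)%R -> 0 <= (Num.min (z + k%:R) K)%:E.
  by move=> z0; rewrite lee_fin le_min addr_ge0.
have rx0 : (0 <= r * x)%R by rewrite mulr_ge0.
apply: (@le_trans _ _ (pexp x (fun k => pexp s (fun l =>
    (Num.min (y + r * k%:R + l%:R) K)%:E)))); last first.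
  apply: le_pexp => // k.
    by apply: pexp_ge0 => // l; rewrite m0// addr_ge0// mulr_ge0.
  under [X in _ <= iter_pexp _ X]eq_fun do rewrite addrA.
  by apply: IH => //; rewrite addr_ge0// mulr_ge0.
rewrite pexp_interchange//; last first.
  by move=> k l; rewrite m0// addr_ge0// mulr_ge0.
rewrite addrC -pexp_add//; last by move=> k; exact: m0.
apply: le_pexp => // l.
  by apply: pexp_ge0 => // k; exact: m0.
under [X in _ <= pexp _ X]eq_fun do rewrite addrAC.
under [X in pexp _ X <= _]eq_fun do rewrite natrD addrA.
by apply: pexp_jump_le => //; rewrite addr_ge0.
Qed.

(** The variables are size-biased one after the other; t and y stand for the
    number and the total size of the jumps of the variables already treated. *)
Lemma iter_pexp_large_jumps ps t y d :
  (forall p, p \in ps -> (0 <= p.1)%R /\ (0 <= p.2)%R) -> (0 <= y)%R ->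
  iter_pexp (unzip1 ps) (fun ks => (if (t + sumn ks <= d)%N
    then y + weighted_sum (unzip2 ps) ks else d%:R)%:E) =
  pexp (\sum_(p <- ps) p.1)%R
    (fun k => (if (t + k <= d)%N then y else d%:R)%:E) +
  (\sum_(p <- ps) p.2 * p.1)%R%:E *
    pexp (\sum_(p <- ps) p.1)%R (fun k => (t + k.+1 <= d)%:R%:E).
Proof.
elim: ps t y => [|[x r] ps IH] t y ps0 y0.
  rewrite !big_nil mul0e adde0 pexp0/=; first by rewrite addr0.
  by move=> k; rewrite lee_fin; case: ifP.
have [/= x0 r0] := ps0 _ (mem_head _ _).
have {}ps0 p : p \in ps -> (0 <= p.1)%R /\ (0 <= p.2)%R.
  by move=> pps; apply: ps0; rewrite in_cons pps orbT.
rewrite !big_cons /=; set s := (\sum_(p <- ps) p.1)%R.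
set a := (\sum_(p <- ps) _)%R.
have s0 : (0 <= s)%R by rewrite /s big_seq sumr_ge0// => p /ps0[].
have a0 : (0 <= a)%R.
  by rewrite /a big_seq sumr_ge0// => p /ps0[? ?]; rewrite mulr_ge0.
have i0 (b : bool) : 0 <= b%:R%:E :> \bar R by rewrite lee_fin.
have y0' (b : bool) : 0 <= (if b then y else d%:R)%:E :> \bar R.
  by rewrite lee_fin; case: b.
transitivity (pexp x (fun k =>
    pexp s (fun l => (if (t + (k + l) <= d)%N then y else d%:R)%:E) +
    r%:E * (k%:R%:E * pexp s (fun l => (t + (k + l) <= d)%:R%:E)) +
    a%:E * pexp s (fun l => (t + (k + l).+1 <= d)%:R%:E))).
  apply: eq_pexp => k.
  under [X in iter_pexp _ X]eq_fun do rewrite addnA addrA.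
  rewrite IH//; last by rewrite addr_ge0// mulr_ge0.
  congr (_ + _); last first.
    by congr (_ * _); apply: eq_pexp => l; rewrite !addnS addnA.
  rewrite muleA -EFinM -pexpZ// -pexpD//; last first.
    by move=> l; rewrite mule_ge0// lee_fin mulr_ge0.
  apply: eq_pexp => l; rewrite addnA; case: ifP => _; rewrite -EFinM -EFinD.
    by rewrite mulr1.
  by rewrite mulr0 addr0.
have P0 (f : nat -> bool) : 0 <= pexp s (fun l => (f l)%:R%:E).
  exact: pexp_ge0.
rewrite pexpD//; last 2 first.
- move=> k; apply: adde_ge0; first exact: pexp_ge0.
  by rewrite !mule_ge0// lee_fin.
- by move=> k; rewrite mule_ge0// lee_fin.
rewrite pexpD//; last 2 first.
- by move=> k; exact: pexp_ge0.
- by move=> k; rewrite !mule_ge0// lee_fin.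
rewrite pexpZ//; last by move=> k; rewrite mule_ge0// lee_fin.
rewrite pexp_natM// (pexpZ x0 a)//.
rewrite (pexp_add x0 s0 (fun k => y0' (t + k <= d)%N)).
rewrite (pexp_add x0 s0 (fun k => i0 (t + k.+1 <= d)%N)).
rewrite -addeA; congr (_ + _).
have : 0 <= pexp (x + s) (fun k => (t + k.+1 <= d)%:R%:E).
  by apply: pexp_ge0 => //; rewrite addr_ge0.
by move=> ?; rewrite muleA -EFinM EFinD ge0_muleDl// lee_fin mulr_ge0.
Qed.

(** The right-hand side is the tangent at L of the concave function [pmin d],
    evaluated at a: its slope is the probability that fewer than d customers come,
    since only then is a further customer served. *)
Lemma pmin_le_tangent d (L a : R) : (0 <= L <= a)%R ->
  pmin d%:R a <= pexp L (fun k => (if (k <= d)%N then 0 else d%:R)%:E) +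
                 a%:E * pexp L (fun k => (k.+1 <= d)%:R%:E).
Proof.
move=> /andP[L0 La].
pose b := (a - L)%R; have b0 : (0 <= b)%R by rewrite subr_ge0.
have -> : a = (L + b)%R by rewrite addrC subrK.
have m0 (k : nat) : 0 <= (Num.min k%:R d%:R : R)%:E.
  by rewrite lee_fin le_min !ler0n.
have i0 (c : bool) : 0 <= c%:R%:E :> \bar R by rewrite lee_fin.
have o0 (c : bool) : 0 <= (if c then 0 else d%:R)%:E :> \bar R.
  by rewrite lee_fin; case: c.
have Q0 : 0 <= pexp L (fun k => (k.+1 <= d)%:R%:E) by apply: pexp_ge0.
rewrite /pmin -pexp_add//.
apply: (@le_trans _ _ (pexp L (fun k =>
    (if (k <= d)%N then 0 else d%:R)%:E + k%:R%:E * (k <= d)%:R%:E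
    + b%:E * (k.+1 <= d)%:R%:E))).
  apply: le_pexp => // k; first exact: pexp_ge0.
  apply: (@le_trans _ _ (pexp b (fun l => (Num.min k%:R d%:R)%:E +
      (k.+1 <= d)%:R%:E * l%:R%:E))).
    apply: le_pexp => // l; rewrite -EFinM -EFinD lee_fin natrD.
    have k0 : (0 <= k%:R :> R)%R by [].
    have l0 : (0 <= l%:R :> R)%R by [].
    case: ltnP; rewrite -?(ltr_nat R) -?(ler_nat R) => kd;
      rewrite ?mul1r ?mul0r ?addr0.
      by rewrite /Num.min; case: ifPn; case: ifPn; rewrite -?leNgt; lra.
    by rewrite /Num.min; case: ifPn; case: ifPn; rewrite -?leNgt; lra.
  rewrite pexpD// pexpZ// pexp_cst// pexp_nat// [X in _ + X <= _]muleC.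
  rewrite leeD2r// -EFinM -EFinD lee_fin.
  case: ltnP => kd; rewrite ?mulr0 ?mulr1 ?addr0 ?add0r ge_min lexx ?orbT//.
rewrite pexpD//; last 2 first.
- by move=> k; rewrite adde_ge0// mule_ge0// lee_fin.
- by move=> k; rewrite mule_ge0// lee_fin.
rewrite pexpD// pexp_natM// pexpZ//.
by rewrite -addeA (EFinD L b) [in leRHS]ge0_muleDl.
Qed.

(** With jumps of size at least 1 the number of jumps has a parameter L that is
    at most the mean a of their sum, and size-biasing turns the right-hand side
    into the tangent at L. *)
Lemma pmin_le_large_jumps ps d :
  (forall p, p \in ps -> (0 <= p.1)%R /\ (1 <= p.2)%R) ->
  pmin d%:R (\sum_(p <- ps) p.2 * p.1)%R <=
  iter_pexp (unzip1 ps) (fun ks => (if (sumn ks <= d)%N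
    then weighted_sum (unzip2 ps) ks else d%:R)%:E).
Proof.
move=> ps0.
have := @iter_pexp_large_jumps ps 0 0%R d.
under [X in iter_pexp _ X]eq_fun do rewrite add0n add0r.
move=> ->//; last first.
  by move=> p /ps0[p0 p1]; split=> //; exact: le_trans p1.
apply: pmin_le_tangent.
rewrite big_seq sumr_ge0//=; last by move=> p /ps0[].
rewrite [leRHS]big_seq ler_sum// => p /ps0[p0 p1].
by rewrite ler_peMl.
Qed.

End PoissonFamily.

(** * The three ratios *)

Section Ratios.
Variable R : realType.
Implicit Types (a : R) (k d : nat).
Local Open Scope ereal_scope.

Lemma EFin_limn_series (f : nat -> R) n : (forall k, (0 <= f k)%R) ->
  \sum_(n <= k <oo) (f k)%:E < +oo ->
  (limn (fun N => \sum_(n <= k < N) f k : R)%R)%:E = \sum_(n <= k <oo) (f k)%:E.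
Proof.
move=> f0 foo.
have s0 : 0 <= \sum_(n <= k <oo) (f k)%:E.
  by apply: nneseries_ge0 => k _ _; rewrite lee_fin.
rewrite -EFin_lim.
  by apply/congr_lim/funext => N /=; rewrite sumEFin.
apply: nondecreasing_is_cvgn.
  move=> p q pq; have [np|pn] := leqP n p.
    by rewrite (big_cat_nat np pq)/= lerDl sumr_ge0.
  by rewrite [leLHS]big_geq ?(ltnW pn)// sumr_ge0.
exists (fine (\sum_(n <= k <oo) (f k)%:E)) => _ [N _ <-].
rewrite -lee_fin fineK ?ge0_fin_numE// -sumEFin.
by apply: nneseries_lim_ge => k _; rewrite lee_fin.
Qed.

Lemma pexp_fin_num a (f : nat -> \bar R) (c : R) : (0 <= a)%R ->
  (forall k, 0 <= f k) -> (forall k, f k <= c%:E) -> pexp a f \is a fin_num.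
Proof.
move=> a0 f0 fc; rewrite ge0_fin_numE ?pexp_ge0//.
by apply: (@le_lt_trans _ _ (pexp a (fun=> c%:E)));
  rewrite ?le_pexp// pexp_cst// ltry.
Qed.

Lemma pexp_indic a k : (0 <= a)%R ->
  pexp a (fun l => (l == k)%:R%:E) = (pois a k)%:E.
Proof.
move=> a0; rewrite /pexp (@nneseriesD1 _ _ k)//; last first.
  by move=> l _; rewrite mule_ge0// lee_fin pois_ge0.
rewrite eqxx mule1 eseries_cond eseries0 ?adde0// => l _ /andP[/andP[_ lk] _].
by rewrite (negbTE lk) mule0.
Qed.

Lemma pmin_fin_num (K a : R) : (0 <= a)%R -> (0 <= K)%R ->
  pmin K a \is a fin_num.
Proof.
move=> a0 K0; apply: (@pexp_fin_num _ _ K) => // k.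
  by rewrite lee_fin le_min K0 andbT.
by rewrite lee_fin ge_min lexx orbT.
Qed.

(** The two sums of [ratio_one_class] are the parts of the expectation below and
    above the d slots. *)
Lemma pmin_series d a : (0 <= a)%R ->
  (\sum_(1 <= k < d.+1) expR (- a) * a ^+ k / (k.-1)`!%:R
   + limn (fun N => \sum_(d.+1 <= k < N)
             d%:R * expR (- a) * a ^+ k / k`!%:R : R))%:E = pmin d%:R a.
Proof.
move=> a0.
have m0 (k : nat) : 0 <= (Num.min k%:R d%:R : R)%:E.
  by rewrite lee_fin le_min !ler0n.
have t0 k : 0 <= (pois a k)%:E * (Num.min k%:R d%:R : R)%:E.
  by rewrite mule_ge0// lee_fin pois_ge0.
have P := pmin_fin_num a0 (ler0n R d).
rewrite /pmin /pexp in P *.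
rewrite (nneseries_split 0%N d.+1)// in P *.
rewrite add0n in P *.
have tE : \sum_(d.+1 <= k <oo) (pois a k)%:E * (Num.min k%:R d%:R : R)%:E =
    \sum_(d.+1 <= k <oo) (d%:R * expR (- a) * a ^+ k / k`!%:R)%:E.
  rewrite eseries_cond [RHS]eseries_cond; apply: eq_eseriesr => k /andP[_ dk].
  rewrite -EFinM; congr EFin; rewrite minEle ler_nat leqNgt dk/= /pois.
  by ring.
rewrite EFinD; congr (_ + _).
  rewrite [RHS]big_nat_recl// minEle ler0n mule0 add0e -sumEFin big_add1/=.
  rewrite !big_nat; apply: eq_bigr => k /andP[_ kd].
  rewrite -EFinM; congr EFin.
  by rewrite minEle ler_nat kd poisSM /pois exprS; ring.
rewrite tE; apply: EFin_limn_series.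
  by move=> k; rewrite !mulr_ge0 ?expR_ge0 ?exprn_ge0.
rewrite -tE; move: P; rewrite fin_numD => /andP[_].
by rewrite ge0_fin_numE//; apply: nneseries_ge0.
Qed.

(** The expected number of customers that d - 1 slots turn away, when a
    Poisson(d) number of customers comes. *)
Definition overflow d : \bar R :=
  pexp d%:R (fun k => (k - d.-1)%N%:R%:E).

Lemma overflow_pmin d : pmin d.-1%:R d%:R + overflow d = d%:R%:E.
Proof.
have m0 (k : nat) : 0 <= (Num.min k%:R d.-1%:R : R)%:E.
  by rewrite lee_fin le_min !ler0n.
rewrite -pexpD// -[RHS]pexp_nat//; apply: eq_pexp => k.
rewrite -EFinD; congr EFin; rewrite minEle ler_nat.
case: ifPn => kd; first by rewrite (eqP kd) addr0.
by rewrite -natrD subnKC// ltnW// ltnNge.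
Qed.

Lemma overflow_fin_num d : overflow d \is a fin_num.
Proof.
have := overflow_pmin d; case: (overflow d) => [//||].
- by rewrite -(@fineK _ (pmin _ _)) ?pmin_fin_num.
- by rewrite -(@fineK _ (pmin _ _)) ?pmin_fin_num.
Qed.

(** The series of [ratio_all] thus measures the customers turned away by d - 1
    slots; [overflow_pmin] converts it into those served. *)
Lemma overflow_series d : (0 < d)%N ->
  (d%:R * (expR (- d%:R) *
       limn (fun N => \sum_(d <= i < N)
               (i - d + 1)%N%:R * d%:R ^+ i.-1 / i`!%:R : R)))%:E = overflow d.
Proof.
move=> d0.
have d0' : (0 < d%:R :> R)%R by rewrite ltr0n.
have c0 : (0 < d%:R * expR (- d%:R) :> R)%R by rewrite mulr_gt0// expR_gt0.
have f0 i : (0 <= (i - d + 1)%N%:R * d%:R ^+ i.-1 / i`!%:R :> R)%R.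
  by rewrite !mulr_ge0 ?exprn_ge0.
have E : (d%:R * expR (- d%:R))%:E *
    \sum_(d <= i <oo) ((i - d + 1)%N%:R * d%:R ^+ i.-1 / i`!%:R : R)%:E
    = overflow d.
  rewrite -nneseriesZl; last by move=> i _; rewrite lee_fin.
  rewrite /overflow /pexp (nneseries_split 0%N d); last first.
    by move=> k _; rewrite mule_ge0// lee_fin pois_ge0.
  rewrite add0n big_nat big1 ?add0e; last first.
    move=> k /andP[_ kd]; have -> : (k - d.-1 = 0)%N by apply/eqP; case: d d0 kd {d0' c0 f0}.
    by rewrite mule0.
  rewrite eseries_cond [RHS]eseries_cond; apply: eq_eseriesr => k /andP[_ dk].
  rewrite -!EFinM; congr EFin.
  have -> : (k - d + 1 = k - d.-1)%N by rewrite addn1 -subSn// -{1}(prednK d0) subSS.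
  have k0 : (0 < k)%N by exact: leq_trans dk.
  rewrite /pois -[in RHS](prednK k0) exprS.
  by rewrite prednK//; ring.
rewrite mulrA EFinM EFin_limn_series//.
have := overflow_fin_num d; rewrite -E.
set S := \sum_(_ <= _ <oo) _.
have : 0 <= S by apply: nneseries_ge0 => k _ _; rewrite lee_fin.
case: S => [s||] // _; first by rewrite ltry.
by rewrite gt0_muley ?lte_fin.
Qed.

(** Size-biasing the excess leaves the upper tail of the Poisson(d) law, which is
    at most 1, and d times its mass at d. *)
Lemma overflow_le d : (0 < d)%N -> overflow d <= (1 + d%:R * pois d%:R d)%:E.
Proof.
case: d => // d _; pose a : R := d.+1%:R.
pose Q := pexp a (fun k => (d < k)%N%:R%:E).
have i0 (c : bool) : 0 <= c%:R%:E :> \bar R by rewrite lee_fin.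
have Q1 : Q <= 1.
  rewrite -(@pexp_cst R a _ 1)//; apply: le_pexp => // k.
  by rewrite lee_fin lern1 leq_b1.
have Q0 : 0 <= Q by exact: pexp_ge0.
have Qf : Q \is a fin_num by rewrite ge0_fin_numE// (le_lt_trans Q1)// ltry.
have E : overflow d.+1 + d%:R%:E * Q = a%:E * (Q + (pois a d)%:E).
  rewrite -(@pexp_indic a d)// -pexpD// -pexpZ//.
  rewrite -[in LHS]pexpD//.
  transitivity (pexp a (fun k => k%:R%:E * (d < k)%N%:R%:E)).
    apply: eq_pexp => k /=; rewrite -!EFinM -EFinD; congr EFin.
    case: ltnP => dk; rewrite ?mulr1 ?mulr0 ?addr0.
      by rewrite -natrD subnK// ltnW.
    by rewrite (eqP dk).
  rewrite pexp_natM// -pexpZ//.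
  rewrite -pexpZ//; last first.
    by move=> k; rewrite adde_ge0.
  apply: eq_pexp => k; rewrite -EFinD; congr (_ * _%:E).
  by rewrite ltnS leq_eqVlt eq_sym; case: ltngtP; rewrite ?addr0 ?add0r.
have := overflow_fin_num d.+1; move: Qf Q1 E.
case: Q {Q0} => [q||]// _ Q1; case: (overflow _) => [w||]// E _.
have {}E : (w + d%:R * q = a * (q + pois a d))%R by exact: EFin_inj E.
move: Q1; rewrite !lee_fin => q1.
have := poisSM a d; rewrite -/a mulrC => ->.
rewrite /a -natr1 in E; rewrite -/a in E.
have -> : w = (q + a * pois a d)%R by rewrite /a -natr1 in E *; lra.
by rewrite lerD2r.
Qed.

(** The mass at d provides the main term; its Stirling error and the upper tail
    contribute 1/d each. *)
Lemma ratio_all_factor_ge d : (0 < d)%N ->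
  (1 - (Num.sqrt (2 * pi * d%:R))^-1 - 2 / d%:R <=
  1 - expR (- d%:R) *
       limn (fun N => \sum_(d <= i < N)
               (i - d + 1)%N%:R * d%:R ^+ i.-1 / i`!%:R : R))%R.
Proof.
move=> d0.
have d0' : (0 < d%:R :> R)%R by rewrite ltr0n.
have := overflow_le d0; rewrite -overflow_series// lee_fin.
rewrite -addrA lerD2l -opprD lerN2.
set z := (expR _ * _)%R => H.
have := poisson_mode_le R d0.
rewrite -/(pois d%:R d) => H2.
have : (z <= d%:R^-1 + pois d%:R d)%R.
  rewrite -(ler_pM2l d0') (le_trans H)// mulrDr divff ?gt_eqF//.
have := H2; rewrite mulr_natl mulr2n; lra.
Qed.

End Ratios.

(** * The admission rule on a single resource *)

Section Greedy.
Variables (R : realType) (n : nat).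
Implicit Types (E : pred 'I_n) (u F : 'I_n -> R) (s : seq 'I_n).

(** A resource on its own, fed with the requests made to it, where E is the set of
    eligible types; [admission_sum] splits [admission] into these. *)
Fixpoint greedy E u (rem : R) s : R :=
  if s is i :: s' then
    if (u i <= rem) && E i then u i + greedy E u (rem - u i) s'
    else greedy E u rem s'
  else 0.

Lemma greedy_ge0 E u rem s : (forall i, 0 <= u i) -> 0 <= greedy E u rem s.
Proof.
move=> u0; elim: s rem => [|i s IH] rem //=.
by case: ifP => _ //; rewrite addr_ge0.
Qed.

(** Once a request of size at most v is refused, less than v is left. *)
Lemma greedy_ge_min E u v rem s : (forall i, 0 <= u i) ->
  (forall i, E i -> u i <= v) ->
  Num.min (\sum_(i <- s | E i) u i) (rem - v) <= greedy E u rem s.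
Proof.
move=> u0 uv; elim: s rem => [|i s IH] rem /=.
  by rewrite big_nil ge_min lexx.
rewrite big_cons; case Ei: (E i); last by rewrite andbF.
rewrite andbT; case: (leP (u i) rem) => ui; last first.
  apply: le_trans (greedy_ge0 _ _ _ u0); rewrite ge_min; apply/orP; right.
  by rewrite subr_le0 (le_trans (ltW ui))// uv.
apply: le_trans (_ : u i + Num.min (\sum_(j <- s | E j) u j) (rem - u i - v) <= _).
  by rewrite addr_minr addrCA addrA [u i + _]addrC subrK.
by rewrite lerD2l.
Qed.

(** The first d requests of size at most hi fit; a (d+1)-st request only ever
    comes after d of them, which allocated at least lo each. *)
Lemma greedy_ge_large E u lo hi d rem s : 0 <= lo -> (forall i, 0 <= u i) ->
  (forall i, E i -> lo <= u i <= hi) -> d%:R * hi <= rem ->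
  (if (count E s <= d)%N then \sum_(i <- s | E i) u i else d%:R * lo)
    <= greedy E u rem s.
Proof.
move=> lo0 u0 uE; elim: s d rem => [|i s IH] d rem dr /=.
  by rewrite big_nil.
rewrite big_cons; case Ei: (E i); last by rewrite andbF add0n IH.
rewrite andbT add1n; have /andP[ul uh] := uE _ Ei.
case: d dr => [|d] dr; first by rewrite ltn0 mul0r; case: ifP => _;
  rewrite ?addr_ge0// greedy_ge0.
have hi0 : 0 <= hi by exact: le_trans (u0 i) uh.
have dr' : d%:R * hi <= rem - u i.
  rewrite lerBrDr (le_trans _ dr)// -natr1 mulrDl mul1r lerD2l//.
have -> : u i <= rem.
  by rewrite -subr_ge0 (le_trans _ dr')// mulr_ge0.
rewrite ltnS; apply: le_trans (_ : u i + (if (count E s <= d)%N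
  then \sum_(i <- s | E i) u i else d%:R * lo) <= _); last by rewrite lerD2l IH.
by case: ifP => // _; rewrite -natr1 mulrDl mul1r addrC lerD2r.
Qed.

Lemma big_seq_types E F s :
  \sum_(i <- s | E i) F i = \sum_(i | E i) F i * (count_mem i s)%:R.
Proof.
elim: s => [|i s IH] /=.
  by rewrite big_nil big1// => i _; rewrite mulr0.
under [RHS]eq_bigr do rewrite natrD mulrDr.
rewrite big_cons big_split/= -IH.
rewrite [X in _ = X + _](_ : _ = if E i then F i else 0); last first.
  rewrite (eq_bigr (fun k => if k == i then F i else 0)); last first.
    by move=> k _; rewrite eq_sym; case: eqP => [->|_]; rewrite ?mulr1 ?mulr0.
  rewrite -big_mkcondr/=; case: ifP => Ei.
    rewrite (big_pred1 i)// => k /=.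
    by have [->|] := eqVneq k i; rewrite ?Ei ?andbF.
  by rewrite big_pred0// => k; have [->|] := eqVneq k i; rewrite ?Ei ?andbF.
by case: ifP => _; rewrite ?add0r.
Qed.

Lemma count_types E s : count E s = (\sum_(i | E i) count_mem i s)%N.
Proof.
apply/eqP; rewrite -(@eqr_nat R) natr_sum -sum1_count natr_sum.
by rewrite big_seq_types; apply/eqP/eq_bigr => i _; rewrite mul1r.
Qed.

End Greedy.

Section SingleResource.
Variables (R : realType) (n m : nat) (I : instance R n m) (d : nat).
Implicit Types (j : 'I_m) (i : 'I_n) (p : 'I_n -> nat -> option 'I_m).

Definition requests j (reqs : seq ('I_n * option 'I_m)) : seq 'I_n :=
  [seq r.1 | r <- reqs & r.2 == Some j].

(** The resources do not interact once the requests are routed. *)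
Lemma admission_sum rsv rem reqs : admission I d rsv rem reqs =
  \sum_j greedy (eligible I d (rsv j) j) (usage I ^~ j) (rem j)
           (requests j reqs).
Proof.
elim: reqs rem => [|[i [k|]] reqs IH] rem /=.
- by rewrite big1.
- rewrite [RHS](bigD1 k)//= /requests /= eqxx /= -/(requests k reqs).
  rewrite [X in _ = _ + X](eq_bigr (fun j => greedy (eligible I d (rsv j) j)
      (usage I ^~ j) (rem j) (requests j reqs))); last first.
    move=> j jk; rewrite /requests /= ifF//.
    by apply/negP => /eqP[kj]; rewrite kj eqxx in jk.
  case: ifP => _; rewrite IH (bigD1 k)//= eqxx addrA; congr (_ + _).
  by apply: eq_bigr => j jk; rewrite (negbTE jk).
- by rewrite IH.
Qed.

Definition routed_count p j i N : nat :=
  (\sum_(0 <= q < N) (p i q == Some j))%N.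

(** The customers of type i that come after [seen] use the picks of index at
    least [count_mem i seen]; the induction is over the later customers. *)
Lemma count_mem_requests p j i (s : seq 'I_n) :
  count_mem i (requests j (routed p [::] s)) =
  routed_count p j i (count_mem i s).
Proof.
suff H seen : count_mem i (requests j (routed p seen s)) =
   (\sum_(count_mem i seen <= q < count_mem i seen + count_mem i s)
      (p i q == Some j))%N by rewrite H.
elim: s seen => [|k s IH] seen /=; first by rewrite addn0 big_geq.
rewrite /requests/=; have [kj|kj] := ifP; rewrite /= -/(requests _ _) IH /=.
  have [<-|_] /= := eqVneq k i; last by rewrite !add0n.
  rewrite add1n addSn addnS [in RHS]big_ltn; last first.
    by rewrite ltnS leq_addr.
  by rewrite kj.
have [ki|_] /= := eqVneq k i; last by rewrite !add0n.
rewrite add1n addSn addnS [in RHS]big_ltn; last by rewrite ltnS leq_addr.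
by rewrite -ki kj.
Qed.

End SingleResource.

(** * Thinning of the arrival processes *)

Section IndependentEvents.
Context (R : realType) (disp : measure_display) (W : measurableType disp)
  (P : probability W R) (K : eqType).
Variable F : K -> set (set W).
Hypothesis mF : forall k B, F k B -> measurable B.
Implicit Types (D : pred K) (A B : set W).
Local Open Scope ereal_scope.

(** The invariant of the exploration that reveals the sources one at a time: D
    indexes the sources that are still fresh, given the event A observed so
    far. *)
Definition indep_event D A := measurable A /\
  forall (s : seq K) (E : K -> set W), uniq s -> {in s, forall k, D k} ->
    (forall k, k \in s -> F k (E k)) ->
    P (A `&` \bigcap_(k in [set` s]) E k) = P A * \prod_(k <- s) P (E k).

Lemma measurable_bigcap_seq (s : seq K) (E : K -> set W) :
  (forall k, k \in s -> F k (E k)) -> measurable (\bigcap_(k in [set` s]) E k).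
Proof.
move=> FE; apply: fin_bigcap_measurable; first exact: finite_seq.
by move=> k /= ks; apply: mF; exact: FE.
Qed.

Lemma indep_event_setT D : mutually_independent P F -> indep_event D setT.
Proof.
move=> iF; split=> // s E us _ sF.
by rewrite setTI probability_setT mul1e iF.
Qed.

Lemma indep_event_sub D D' A : {subset D' <= D} ->
  indep_event D A -> indep_event D' A.
Proof.
move=> DD' [mA iA]; split=> // s E us sD sF; apply: iA => // k ks.
by apply: DD'; exact: sD.
Qed.

Lemma indep_event_cap D A k B : indep_event D A -> D k -> F k B ->
  P (A `&` B) = P A * P B.
Proof.
move=> [mA iA] Dk FB.
have := iA [:: k] (fun=> B) erefl; rewrite big_seq1 => <-.
- congr (P (_ `&` _)); apply/seteqP; split=> w /=.
    by move=> Bw k' _.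
  by move=> /(_ k); apply; rewrite /= inE.
- by move=> k'; rewrite inE => /eqP ->.
- by move=> k'; rewrite inE => /eqP ->.
Qed.

Lemma indep_event_setI D A k B : indep_event D A -> D k -> F k B ->
  indep_event [pred k' | D k' && (k' != k)] (A `&` B).
Proof.
move=> iA Dk FB; have [mA iA'] := iA.
split=> [|s E us sD sF]; first by apply: measurableI => //; exact: mF FB.
have ks : k \notin s by apply/negP => /sD/=; rewrite eqxx andbF.
pose E' k' := if k' == k then B else E k'.
have EE' k' : k' \in s -> E' k' = E k'.
  by move=> k's; rewrite /E'; case: eqP => // k'k; rewrite -k'k k's in ks.
have := iA' (k :: s) E'; rewrite /= ks us big_cons => /(_ erefl) H.
rewrite -setIA (_ : B `&` _ = \bigcap_(k' in [set` k :: s]) E' k').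
  rewrite H.
  - rewrite /E' eqxx (indep_event_cap iA Dk FB) -muleA; congr (_ * (_ * _)).
    by apply: eq_big_seq => k' k's; have := EE' _ k's; rewrite /E' => ->.
  - by move=> k'; rewrite inE => /predU1P[->//|/sD/andP[]].
  - move=> k'; rewrite inE => /predU1P[->|k's]; first by rewrite /E' eqxx.
    by rewrite EE'//; exact: sF.
apply/seteqP; split=> w /=.
  move=> [Bw Ew] k' /=; rewrite inE => /predU1P[->|k's].
    by rewrite /E' eqxx.
  by rewrite EE'//; exact: Ew.
move=> Ew; split; first by have := Ew k; rewrite /E' eqxx; apply; rewrite /= mem_head.
by move=> k' k's; rewrite -EE'//; apply: Ew; rewrite /= inE k's orbT.
Qed.

Lemma prod_prob_fin_num (s : seq K) (E : K -> set W) :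
  (forall k, k \in s -> measurable (E k)) ->
  \prod_(k <- s) P (E k) \is a fin_num.
Proof.
elim: s => [|k s IH] mE; first by rewrite big_nil.
have mEk : measurable (E k) by apply: mE; rewrite mem_head.
rewrite big_cons fin_numM ?fin_num_measure//.
by apply: IH => k' k's; apply: mE; rewrite inE k's orbT.
Qed.

Lemma probability_bigcup (A : nat -> set W) : (forall l, measurable (A l)) ->
  trivIset setT A -> P (\bigcup_l A l) = \sum_(l <oo) P (A l).
Proof.
move=> mA tA; rewrite measure_bigcup//.
by apply: eq_eseriesl => l; rewrite in_setT.
Qed.

Lemma indep_event_bigcup D (A : nat -> set W) : trivIset setT A ->
  (forall l, indep_event D (A l)) -> indep_event D (\bigcup_l A l).
Proof.
move=> tA iA.
have mA l : measurable (A l) by have [] := iA l.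
split=> [|s E us sD sF]; first exact: bigcupT_measurable.
have mE := measurable_bigcap_seq sF.
rewrite setI_bigcupl probability_bigcup//; last 2 first.
- by move=> l; exact: measurableI.
- exact: trivIset_setIr.
rewrite probability_bigcup//.
set c := \prod_(_ <- _) _.
have cf : c \is a fin_num by apply: prod_prob_fin_num => k /sF; exact: mF.
rewrite -[c]fineK// muleC -nneseriesZl//.
apply: eq_eseriesr => l _; rewrite fineK// muleC.
by have [_] := iA l; apply.
Qed.

Lemma probability_setU A B : measurable A -> measurable B ->
  A `&` B = set0 -> P (A `|` B) = P A + P B.
Proof. by move=> mA mB AB; rewrite measureU. Qed.

Lemma indep_event_setU D A B : A `&` B = set0 ->
  indep_event D A -> indep_event D B -> indep_event D (A `|` B).
Proof.
move=> AB [mA iA] [mB iB]; split=> [|s E us sD sF]; first exact: measurableU.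
have mE := measurable_bigcap_seq sF.
rewrite setIUl probability_setU//; last 3 first.
- exact: measurableI.
- exact: measurableI.
- by rewrite setIACA AB set0I.
by rewrite probability_setU// (iA _ _ us sD sF) (iB _ _ us sD sF) ge0_muleDl.
Qed.

End IndependentEvents.

Section Counts.
Context (R : realType) (disp : measure_display) (W : measurableType disp)
  (P : probability W R) (T : Type).
Variable M : T -> W -> nat.
Hypothesis mM : forall i l, measurable [set w | M i w = l].
Local Open Scope ereal_scope.

Lemma measurable_map_counts (s : seq T) (Y : set (seq nat)) :
  measurable [set w | Y [seq M i w | i <- s]].
Proof.
elim: s Y => [|i s IH] Y /=.
  have [Y0|Y0] := pselect (Y [::]).
    by rewrite (_ : [set w | _] = setT)//; apply/seteqP; split.
  by rewrite (_ : [set w | _] = set0)//; apply/seteqP; split.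
rewrite (_ : [set w | _] = \bigcup_k ([set w | M i w = k] `&`
    [set w | Y (k :: [seq M i w | i <- s])])).
  apply: bigcupT_measurable => k; apply: measurableI; first exact: mM.
  exact: (IH (fun ks => Y (k :: ks))).
apply/seteqP; split => w /=; first by move=> Yw; exists (M i w).
by move=> [k _ [<-]].
Qed.

Lemma measurable_fun_counts (s : seq T) (G : seq nat -> \bar R) D :
  measurable_fun D (fun w => G [seq M i w | i <- s]).
Proof.
apply: measurable_funTS => _ Y _; rewrite setTI.
exact: (measurable_map_counts s (fun ks => Y (G ks))).
Qed.

Lemma integral_pois i (g : nat -> \bar R) a : (forall k, 0 <= g k) ->
  (forall k, P [set w | M i w = k] = (pois a k)%:E) ->
  \int[P]_w g (M i w) = pexp a g.
Proof.
move=> g0 PM.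
have TE : setT = \bigcup_k [set w | M i w = k].
  by apply/seteqP; split => w // _; exists (M i w).
rewrite [X in integral _ X _]TE ge0_integral_bigcup//=; last 2 first.
- exact: (measurable_fun_counts [:: i] (fun ks => g (head 0%N ks))).
- apply/trivIsetP => k k' _ _ kk'; apply/seteqP; split => w //=.
  by move=> [e e']; rewrite -e -e' eqxx in kk'.
apply: eq_eseriesr => k _.
rewrite (eq_integral (fun=> g k)); last by move=> w; rewrite inE /= => ->.
by rewrite integral_cst//= [RHS]muleC; congr (_ * _); exact: PM.
Qed.

End Counts.

Section Thinning.
Context (R : realType) (disp : measure_display) (W : measurableType disp)
  (P : probability W R) (n : nat).
Variables (N : 'I_n -> W -> nat) (B : W -> 'I_n -> nat -> bool).
Variables (L r : 'I_n -> R).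
Hypothesis L0 : forall i, (0 <= L i)%R.
Hypothesis r01 : forall i, (0 <= r i <= 1)%R.
Hypothesis mN : forall i l, measurable [set w | N i w = l].
Hypothesis mB : forall i q b, measurable [set w | B w i q = b].
Local Open Scope ereal_scope.
Hypothesis PN : forall i l, P [set w | N i w = l] = (pois (L i) l)%:E.
Hypothesis PB : forall i q, P [set w | B w i q = true] = (r i)%:E.

Let key := ('I_n + 'I_n * nat)%type.

(** Generators that suffice for the thinned counts, in place of the full
    sigma-algebras of the sources. *)
Definition atoms (k : key) : set (set W) :=
  match k with
  | inl i => [set A | exists l, A = [set w | N i w = l]]
  | inr iq => [set A | exists b, A = [set w | B w iq.1 iq.2 = b]]
  end.

Hypothesis indepNB : mutually_independent P atoms.

Definition thinned (i : 'I_n) (w : W) : nat :=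
  (\sum_(0 <= q < N i w) B w i q)%N.

Let type_of (k : key) : 'I_n := match k with inl i => i | inr iq => iq.1 end.

Lemma measurable_atoms (k : key) A : atoms k A -> measurable A.
Proof. by case: k => [i|[i q]] /= [b ->]. Qed.

Let iev := indep_event P atoms.

Let after i l (k : key) : bool :=
  match k with inl i' => i' != i | inr iq => (iq.1 != i) || (l <= iq.2)%N end.

Lemma PBN i q : P [set w | B w i q = false] = (1 - r i)%:E.
Proof.
have -> : [set w | B w i q = false] = ~` [set w | B w i q = true].
  by apply/seteqP; split => w /=; case: (B w i q).
by rewrite probability_setC// PB.
Qed.

(** The marks are revealed one by one. The statement ranges over all predicates g
    because the last mark turns g into its shift. *)
Lemma bernoulli_sum (D : pred key) A i l (g : pred nat) : iev D A ->
  (forall q, D (inr (i, q))) ->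
  iev [pred k | D k && ((k == inl i) || after i l k)]
      (A `&` [set w | g (\sum_(0 <= q < l) B w i q)%N]) /\
  P (A `&` [set w | g (\sum_(0 <= q < l) B w i q)%N]) =
  P A * (bexp (r i) l (fun k => (g k)%:R))%:E.
Proof.
move=> iA Di; have [mA _] := iA.
elim: l g => [|l IH] g.
  have [g0|g0] := boolP (g 0%N).
    have -> : [set w | g (\sum_(0 <= q < 0) B w i q)%N] = setT.
      by apply/seteqP; split => w //= _; rewrite big_geq.
    rewrite setIT /= g0 mule1; split=> //; apply: indep_event_sub iA.
    by move=> k /andP[].
  have -> : [set w | g (\sum_(0 <= q < 0) B w i q)%N] = set0.
    by apply/seteqP; split => w //=; rewrite big_geq// (negbTE g0).
  rewrite setI0 /= (negbTE g0) mule0 measure0; split=> //.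
  split=> // s E _ _ _; by rewrite set0I measure0 mul0e.
pose S g' := A `&` [set w | g' (\sum_(0 <= q < l) B w i q)%N].
have -> : A `&` [set w | g (\sum_(0 <= q < l.+1) B w i q)%N] =
    (S (fun k => g k.+1) `&` [set w | B w i l = true]) `|`
    (S g `&` [set w | B w i l = false]).
  apply/seteqP; split => w /=; rewrite big_nat_recr//=.
    by case: (B w i l) => -[Aw]; rewrite ?addn1 ?addn0 => gw; [left|right].
  by move=> [] [[Aw gw] ->]; rewrite ?addn1 ?addn0.
have [i1 P1] := IH (fun k => g k.+1).
have [i2 P2] := IH g.
have Dl : [pred k | D k && ((k == inl i) || after i l k)] (inr (i, l)).
  by rewrite /= Di leqnn !orbT.
have F1 : atoms (inr (i, l)) [set w | B w i l = true] by exists true.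
have F2 : atoms (inr (i, l)) [set w | B w i l = false] by exists false.
have dis : S (fun k => g k.+1) `&` [set w | B w i l = true] `&`
           (S g `&` [set w | B w i l = false]) = set0.
  by apply/seteqP; split => w //= [[_ ->] []].
have j1 := indep_event_setI measurable_atoms i1 Dl F1.
have j2 := indep_event_setI measurable_atoms i2 Dl F2.
split.
  apply: (indep_event_sub _ (indep_event_setU measurable_atoms dis j1 j2)).
  move=> k; rewrite !inE => /andP[-> /=] /orP[/eqP->|]; first by rewrite eqxx.
  case: k => [i'|[i' q]] /=; first by move=> ->; rewrite orbT.
  move=> H; apply/andP; split.
    by case/orP: H => [->//|lq]; rewrite ?orbT// (ltnW lq) !orbT.
  by apply/eqP => -[ii' ql]; rewrite ii' ql eqxx ltnn in H.
have [mj1 _] := j1; have [mj2 _] := j2.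
rewrite probability_setU//.
rewrite (indep_event_cap i1 Dl F1) (indep_event_cap i2 Dl F2) P1 P2 PB PBN.
have PAf : P A \is a fin_num by rewrite fin_num_measure.
by rewrite -(fineK PAf) -!EFinM -!EFinD; congr EFin => /=; ring.
Qed.

(** Given N i = l, the thinned count is binomial; averaging over l is
    [pexp_thin]. All sources of the other types stay fresh. *)
Lemma thinned_indep (D : pred key) A i k : iev D A ->
  (forall k', type_of k' = i -> D k') ->
  iev [pred k' | D k' && (type_of k' != i)] (A `&` [set w | thinned i w = k]) /\
  P (A `&` [set w | thinned i w = k]) = P A * (pois (r i * L i) k)%:E.
Proof.
move=> iA Di; have [mA _] := iA.
pose An l := A `&` [set w | N i w = l].
pose Al l := An l `&` [set w | (\sum_(0 <= q < l) B w i q)%N == k].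
have AE : A `&` [set w | thinned i w = k] = \bigcup_l Al l.
  apply/seteqP; split => w /=.
    by move=> [Aw wk]; exists (N i w) => //; split=> //=; apply/eqP.
  by move=> [l _ [[Aw <-] /eqP]].
have tA : trivIset setT Al.
  apply/trivIsetP => l l' _ _ ll'; apply/seteqP; split => w //=.
  by move=> [[[_ e] _] [[_ e'] _]]; rewrite -e -e' eqxx in ll'.
have FN l : atoms (inl i) [set w | N i w = l] by exists l.
have iAn l : iev [pred k' | D k' && (k' != inl i)] (An l).
  have := indep_event_setI measurable_atoms iA (Di (inl i) erefl) (FN l).
  exact.
have H l := @bernoulli_sum _ _ i l (pred1 k) (iAn l)
  (fun q => introT andP (conj (Di (inr (i, q)) erefl) erefl)).
have iAl l : iev [pred k' | D k' && (type_of k' != i)] (Al l).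
  have [iAl _] := H l; apply: indep_event_sub iAl => k'; rewrite !inE.
  by case: k' => [i'|[i' q]] /= /andP[-> ii']; rewrite ?ii' ?orbT.
split; first by rewrite AE; have := indep_event_bigcup measurable_atoms tA iAl.
have PAf : P A \is a fin_num by rewrite fin_num_measure.
rewrite AE probability_bigcup//; last by move=> l; have [] := iAl l.
transitivity (\sum_(l <oo) (fine (P A))%:E *
    ((pois (L i) l)%:E * (bexp (r i) l (fun k' => (k' == k)%:R))%:E)).
  apply: eq_eseriesr => l _; have [_ ->] := H l.
  by rewrite fineK// (indep_event_cap iA (Di (inl i) erefl) (FN l)) PN muleA.
rewrite nneseriesZl; last first.
  by move=> l _; rewrite mule_ge0// lee_fin ?pois_ge0// bexp_ge0.
have := pexp_thin (L0 i) (r01 i) (fun k' => ler0n R (k' == k)).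
rewrite /pexp => ->; rewrite fineK//; congr (_ * _).
by rewrite -/(pexp _ _) pexp_indic// mulr_ge0//; case/andP: (r01 i).
Qed.

Lemma measurable_thinned i k : measurable [set w | thinned i w = k].
Proof.
have iT := @indep_event_setT _ _ _ P _ atoms predT indepNB.
by have [[+ _] _] := @thinned_indep _ _ i k iT (fun=> fun=> erefl); rewrite setTI.
Qed.

(** The counts of the types in s are revealed one after the other, each of them
    being Poisson and independent of the event observed so far. *)
Lemma integral_thinned (s : seq 'I_n) (G : seq nat -> \bar R) : uniq s ->
  (forall ks, 0 <= G ks) ->
  \int[P]_w G [seq thinned i w | i <- s] =
  iter_pexp [seq r i * L i | i <- s]%R G.
Proof.
move=> us G0.
suff H (D : pred key) A : iev D A -> (forall k, type_of k \in s -> D k) ->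
    \int[P]_(w in A) G [seq thinned i w | i <- s] =
    P A * iter_pexp [seq r i * L i | i <- s]%R G.
  rewrite (H predT setT) ?probability_setT ?mul1e//.
  exact: indep_event_setT.
elim: s us G G0 D A => [|i s IH] us G G0 D A iA sD; have [mA _] := iA.
  by rewrite /= integral_cst// muleC.
have PAf : P A \is a fin_num by rewrite fin_num_measure.
move: us => /= /andP[is' us].
have H k := @thinned_indep D A i k iA
  (fun k' (e : type_of k' = i) =>
     sD k' (eq_ind_r (fun z => z \in i :: s) (mem_head i s) e)).
have AE : A = \bigcup_k (A `&` [set w | thinned i w = k]).
  by apply/seteqP; split => w; [move=> Aw; exists (thinned i w)|case=> k _ []].
rewrite [X in integral _ X _]AE ge0_integral_bigcup//=; last 3 first.
- by move=> k; have [[]] := H k.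
- exact: (measurable_fun_counts measurable_thinned (i :: s)).
- apply/trivIsetP => k k' _ _ kk'; apply/seteqP; split => w //=.
  by move=> [[_ e] [_ e']]; rewrite -e -e' eqxx in kk'.
transitivity (\sum_(k <oo) (fine (P A))%:E * ((pois (r i * L i) k)%:E *
    iter_pexp [seq (r i * L i)%R | i <- s] (fun ks => G (k :: ks)))).
  apply: eq_eseriesr => k _; have [iAk PAk] := H k.
  rewrite (eq_integral (fun w => G (k :: [seq thinned i w | i <- s]))); last first.
    by move=> w; rewrite inE => -[_ /= ->].
  rewrite (IH us (fun ks => G (k :: ks)) (fun ks => G0 _) _ _ iAk).
    by rewrite PAk fineK// muleA.
  move=> k' k's; apply/andP; split; first by apply: sD; rewrite inE k's orbT.
  by apply: contraNneq is' => <-.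
rewrite nneseriesZl; first by rewrite fineK.
have rL0 i' : (0 <= r i' * L i')%R by rewrite mulr_ge0//; case/andP: (r01 i').
move=> k _; rewrite mule_ge0// ?lee_fin ?pois_ge0//.
by apply: iter_pexp_ge0 => // y /mapP[i' _ ->].
Qed.

End Thinning.

(** * Guarantees for a single resource *)

Section Minorant.
Variables (R : realType) (n : nat).
Implicit Types (E : pred 'I_n) (u x : 'I_n -> R) (s : seq 'I_n).

Lemma weighted_sum_map (r : 'I_n -> R) (M : 'I_n -> nat) s :
  weighted_sum [seq r i | i <- s] [seq M i | i <- s] =
  \sum_(i <- s) r i * (M i)%:R.
Proof. by elim: s => [|i s IH] /=; rewrite ?big_nil ?big_cons ?IH. Qed.

Lemma sumn_map (M : 'I_n -> nat) s :
  sumn [seq M i | i <- s] = (\sum_(i <- s) M i)%N.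
Proof. by rewrite sumnE big_map. Qed.

Lemma weighted_sum_ge0 (rs : seq R) ks : (forall r, r \in rs -> 0 <= r) ->
  0 <= weighted_sum rs ks.
Proof.
elim: rs ks => [|r rs IH] [|k ks] rs0 //=.
have r0 : 0 <= r by rewrite rs0// mem_head.
rewrite addr_ge0//; first by rewrite mulr_ge0.
by apply: IH => r' r'rs; rewrite rs0// in_cons r'rs orbT.
Qed.

Lemma iter_pexpZ (ys : seq R) c (G : seq nat -> \bar R) :
  (forall y, y \in ys -> 0 <= y) -> (forall ks, 0 <= G ks)%E ->
  (iter_pexp ys (fun ks => c%:E * G ks) = c%:E * iter_pexp ys G)%E.
Proof.
elim: ys G => [|y ys IH] G ys0 G0 //=.
have y0 : 0 <= y by rewrite ys0// mem_head.
have ys0' z : z \in ys -> 0 <= z by move=> zys; rewrite ys0// in_cons zys orbT.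
rewrite -pexpZ//; last by move=> k; apply: iter_pexp_ge0.
by apply: eq_pexp => k; rewrite IH.
Qed.

Lemma sum_enum E (F : 'I_n -> R) : \sum_(i <- enum E) F i = \sum_(i | E i) F i.
Proof. by rewrite big_enum. Qed.

(** In units of kappa, the allocation is at least the minimum of the demand and
    K, and the demand is a compound Poisson variable with jumps in [0, 1]. *)
Lemma small_minorant E u x (kappa : R) (K : nat) : 0 < kappa ->
  (forall i, 0 <= u i) -> (forall i, 0 <= x i) ->
  (forall i, E i -> u i <= kappa) ->
  let G ks : R := kappa *
    Num.min (weighted_sum [seq u i / kappa | i <- enum E] ks) K%:R in
  [/\ forall ks, 0 <= G ks,
      forall reqs, G [seq count_mem i reqs | i <- enum E] <=
                   greedy E u (K.+1%:R * kappa) reqs &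
      (kappa%:E * pmin K%:R (\sum_(i | E i) u i / kappa * x i) <=
       iter_pexp [seq x i | i <- enum E] (fun ks => (G ks)%:E))%E].
Proof.
move=> k0 u0 x0 uk G.
have m0 ks : 0 <=
    Num.min (weighted_sum [seq u i / kappa | i <- enum E] ks) K%:R.
  rewrite le_min ler0n andbT; apply: weighted_sum_ge0 => r /mapP[i _ ->].
  by rewrite divr_ge0// ltW.
split.
- by move=> ks; rewrite mulr_ge0// ltW.
- move=> reqs; apply: le_trans (greedy_ge_min _ _ u0 uk).
  rewrite /G (minr_pMr _ _ (ltW k0)) weighted_sum_map sum_enum big_seq_types mulr_sumr.
  rewrite -natr1 mulrDl mul1r addrK [kappa * K%:R]mulrC.
  rewrite (eq_bigr (fun i => u i * (count_mem i reqs)%:R))// => i _.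
  by rewrite mulrA mulrCA divff ?mulr1// gt_eqF.
- rewrite /G; under [X in iter_pexp _ X]eq_fun do rewrite EFinM.
  rewrite iter_pexpZ//; last by move=> y /mapP[i _ ->].
  rewrite lee_wpmul2l//; first by rewrite lee_fin ltW.
  pose ps := [seq (x i, u i / kappa) | i <- enum E].
  have := @pmin_le_small_jumps R ps 0 K%:R; rewrite /pmin.
  have -> : \sum_(p <- ps) p.2 * p.1 = \sum_(i | E i) u i / kappa * x i.
    by rewrite big_map sum_enum.
  have -> : unzip1 ps = [seq x i | i <- enum E] by rewrite /unzip1 -map_comp.
  have -> : unzip2 ps = [seq u i / kappa | i <- enum E].
    by rewrite /unzip2 -map_comp.
  move=> H; apply: le_trans (le_trans (H _ (lexx 0) (ler0n R K)) _).
  - rewrite (_ : (fun k : nat => (Num.min (0 + k%:R) K%:R)%:E) =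
      (fun k : nat => (Num.min k%:R K%:R)%:E))//.
    by apply/funext => k; rewrite add0r.
  - move=> p /mapP[i]; rewrite mem_enum => Ei -> /=.
    split=> //; apply/andP; split; first by rewrite divr_ge0// ltW.
    by rewrite ler_pdivrMr// mul1r uk.
  - rewrite (_ : (fun ks : seq nat => (Num.min (0 + _ ks) K%:R)%:E) =
      (fun ks : seq nat => (Num.min (weighted_sum
         [seq u i / kappa | i <- enum E] ks) K%:R)%:E))//.
    by apply/funext => ks; rewrite add0r.
Qed.

(** In units of kappa, the demand is a compound Poisson variable with jumps of
    size at least 1, and any d of the requests fit. *)
Lemma large_minorant E u x (kappa hi c : R) (d : nat) : 0 < kappa ->
  (forall i, 0 <= u i) -> (forall i, 0 <= x i) ->
  (forall i, E i -> kappa <= u i <= hi) -> d%:R * hi <= c ->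
  let G ks : R := kappa * (if (sumn ks <= d)%N
    then weighted_sum [seq u i / kappa | i <- enum E] ks else d%:R) in
  [/\ forall ks, 0 <= G ks,
      forall reqs, G [seq count_mem i reqs | i <- enum E] <= greedy E u c reqs &
      (kappa%:E * pmin d%:R (\sum_(i | E i) u i / kappa * x i) <=
       iter_pexp [seq x i | i <- enum E] (fun ks => (G ks)%:E))%E].
Proof.
move=> k0 u0 x0 uE dc G.
have m0 ks : 0 <= if (sumn ks <= d)%N
    then weighted_sum [seq u i / kappa | i <- enum E] ks else d%:R.
  case: ifP => // _; apply: weighted_sum_ge0 => r /mapP[i _ ->].
  by rewrite divr_ge0// ltW.
split.
- by move=> ks; rewrite mulr_ge0// ltW.
- move=> reqs.
  apply: le_trans (greedy_ge_large _ (ltW k0) u0 uE dc).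
  rewrite /G sumn_map weighted_sum_map sum_enum big_seq_types (count_types R).
  rewrite big_enum; case: ifP => _; last by rewrite mulrC.
  rewrite mulr_sumr.
  rewrite (eq_bigr (fun i => u i * (count_mem i reqs)%:R))// => i _.
  by rewrite mulrA mulrCA divff ?mulr1// gt_eqF.
- rewrite /G; under [X in iter_pexp _ X]eq_fun do rewrite EFinM.
  rewrite iter_pexpZ//; last by move=> y /mapP[i _ ->].
  rewrite lee_wpmul2l//; first by rewrite lee_fin ltW.
  pose ps := [seq (x i, u i / kappa) | i <- enum E].
  have := @pmin_le_large_jumps R ps d.
  have -> : \sum_(p <- ps) p.2 * p.1 = \sum_(i | E i) u i / kappa * x i.
    by rewrite big_map sum_enum.
  have -> : unzip1 ps = [seq x i | i <- enum E] by rewrite /unzip1 -map_comp.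
  have -> : unzip2 ps = [seq u i / kappa | i <- enum E].
    by rewrite /unzip2 -map_comp.
  apply=> p /mapP[i]; rewrite mem_enum => Ei -> /=.
  split=> //; rewrite ler_pdivlMr// mul1r.
  by have /andP[] := uE _ Ei.
Qed.

End Minorant.

Section ResourceGuarantee.
Variables (R : realType) (n m : nat) (I : instance R n m) (d : nat).
Variables (x : 'I_n -> 'I_m -> R).
Hypothesis d0 : (0 < d)%N.
Hypothesis vI : valid_instance I.
Hypothesis ud : forall i j, usage I i j <= capacity I j / d%:R.
Hypothesis fx : lp_feasible I x.
Implicit Types j : 'I_m.

Let c0 j : 0 < capacity I j. Proof. by case: vI. Qed.
Let u0 i j : 0 <= usage I i j. Proof. by case: vI => _ _ _ /(_ i j)/andP[]. Qed.
Let x0 i j : 0 <= x i j. Proof. by case: fx. Qed.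
Let dR0 : 0 < d%:R :> R. Proof. by rewrite ltr0n. Qed.

Lemma U_allE j : U_all I d x j = \sum_i x i j * usage I i j.
Proof.
rewrite /U_all /U_large /U_small [RHS](bigID (large I d j))/=; congr (_ + _).
by apply: eq_bigl => i; rewrite /small /large -leNgt.
Qed.

Lemma lp_value_U_all : lp_value I x = \sum_j U_all I d x j.
Proof.
by rewrite /lp_value exchange_big/=; apply: eq_bigr => j _; rewrite U_allE.
Qed.

Lemma ratio_one_classE j (E : pred 'I_n) : let kappa := capacity I j / d.+1%:R in
  (capacity I j * ratio_one_class I d j (\sum_(i | E i) x i j * usage I i j))%:E
  = (kappa%:E * pmin d%:R (\sum_(i | E i) usage I i j / kappa * x i j))%E.
Proof.
move=> kappa.
have d10 : d.+1%:R != 0 :> R by rewrite pnatr_eq0.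
have cj := c0 j.
set U := \sum_(i | E i) _.
have -> : \sum_(i | E i) usage I i j / kappa * x i j =
    d.+1%:R * U / capacity I j.
  rewrite /U mulr_sumr mulr_suml; apply: eq_bigr => i _.
  by rewrite /kappa; field; rewrite gt_eqF// nat1r.
have a0 : 0 <= d.+1%:R * U / capacity I j.
  by rewrite !mulr_ge0 ?invr_ge0 ?(ltW cj)// sumr_ge0// => i _; rewrite mulr_ge0.
by rewrite -pmin_series// -EFinM /ratio_one_class mulrA.
Qed.

(** Each of the three modes of operation of a resource is backed by a function
    of the numbers of requests of the eligible types that bounds its allocation
    from below whatever the order of the requests. *)
Lemma ratio_minorant j (r : reservation) :
  let s := enum (eligible I d r j) in
  exists G : seq nat -> R,
  [/\ forall ks, 0 <= G ks,
      forall reqs, G [seq count_mem i reqs | i <- s] <=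
        greedy (eligible I d r j) (usage I ^~ j) (capacity I j) reqs &
      ((capacity I j * Defs.ratio I d x j r)%:E <=
       iter_pexp [seq x i j | i <- s] (fun ks => (G ks)%:E))%E].
Proof.
have cj := c0 j; have d10 : 0 < d.+1%:R :> R by rewrite ltr0n.
pose kappa := capacity I j / d.+1%:R.
have k0 : 0 < kappa by rewrite divr_gt0.
case: r => /=.
- rewrite /U_large ratio_one_classE.
  have uE i : large I d j i -> kappa <= usage I i j <= capacity I j / d%:R.
    by move=> /ltW ->; rewrite ud.
  have [] := @large_minorant R n (large I d j) (usage I ^~ j) (x ^~ j)
    kappa (capacity I j / d%:R) (capacity I j) d k0 (u0 ^~ j) (x0 ^~ j) uE.
    by rewrite mulrC divfK// gt_eqF.
  by move=> G0 Gg H; eexists; split; [exact: G0|exact: Gg|exact: H].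
- rewrite /U_small ratio_one_classE.
  have [] := @small_minorant R n (small I d j) (usage I ^~ j) (x ^~ j)
    kappa d k0 (u0 ^~ j) (x0 ^~ j) (fun i => id).
  rewrite /kappa mulrCA divff ?mulr1 ?gt_eqF//.
  by move=> G0 Gg H; eexists; split; [exact: G0|exact: Gg|exact: H].
- (* There are d - 1 slots of size c / d. The ratio is computed at full load d,
     and concavity transports it to the actual load. *)
  pose kap := capacity I j / d%:R.
  have kap0 : 0 < kap by rewrite divr_gt0.
  have [] := @small_minorant R n predT (usage I ^~ j) (x ^~ j)
    kap d.-1 kap0 (u0 ^~ j) (x0 ^~ j) (fun i _ => ud i j).
  rewrite prednK// {2}/kap mulrCA divff ?mulr1 ?gt_eqF// => G0 Gg H.
  eexists; split; [exact: G0|exact: Gg|apply: le_trans H].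
  rewrite /ratio_all.
  set z := 1 - _.
  have zE : (d%:R * z)%:E = pmin d.-1%:R d%:R :> \bar R.
    have Pf := pmin_fin_num (ler0n R d) (ler0n R d.-1).
    have := overflow_pmin R d; rewrite -overflow_series//.
    rewrite -(fineK Pf) => PE; have H := EFin_inj PE.
    by congr EFin; rewrite /z mulrBr mulr1 -[X in X - _]H addrK.
  have U0 : 0 <= U_all I d x j.
    by rewrite U_allE sumr_ge0// => i _; rewrite mulr_ge0.
  have t01 : 0 <= U_all I d x j / capacity I j <= 1.
    rewrite divr_ge0 ?(ltW cj)//= ler_pdivrMr// mul1r U_allE.
    by case: fx.
  have -> : \sum_(i : 'I_n) usage I i j / kap * x i j =
     U_all I d x j / capacity I j * d%:R.
    rewrite U_allE !mulr_suml; apply: eq_bigr => i _.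
    by rewrite /kap; field; rewrite !gt_eqF.
  apply: le_trans (lee_wpmul2l _ (pmin_scale (ltW dR0) t01 (ler0n R d.-1))).
    rewrite -zE -!EFinM lee_fin /kap le_eqVlt; apply/orP; left; apply/eqP.
    by field; rewrite !gt_eqF.
  by rewrite lee_fin ltW.
Qed.

End ResourceGuarantee.

(** * The linear program bounds the offline optimum *)

(** The integral of a nonnegative function is a supremum over the simple functions
    below it, hence monotone on arbitrary functions. The allocation of the
    algorithm depends on the order of the arrivals and is compared in this way
    with functions of finitely many counts. *)
Lemma ge0_le_integral_lower d (T : measurableType d) (R : realType)
    (mu : {measure set T -> \bar R}) (f g : T -> \bar R) :
  (forall w, 0 <= f w)%E -> (forall w, f w <= g w)%E ->
  (\int[mu]_w f w <= \int[mu]_w g w)%E.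
Proof.
move=> f0 fg; rewrite !ge0_integralTE//; last first.
  by move=> w; exact: le_trans (fg w).
apply: le_ereal_sup => _ [h /= hf <-]; exists h => //= w.
exact: le_trans (fg w).
Qed.

Section OfflineAssignment.
Variables (R : realType) (n m : nat) (I : instance R n m).
Hypothesis vI : valid_instance I.
Local Notation u := (usage I).
Local Notation c := (capacity I).

Let u0 i j : 0 <= u i j. Proof. by case: vI => _ _ _ /(_ i j)/andP[]. Qed.

Lemma opt_types_ge0 (s : seq 'I_n) : 0 <= opt_types I s.
Proof.
rewrite /opt_types; elim/big_ind: _ => // [a b a0 b0|f _].
  by rewrite le_max a0.
by rewrite sumr_ge0// => k _; case: (f k).
Qed.

Definition total_usage (y : 'I_n -> 'I_m -> nat) : R :=
  \sum_i \sum_j u i j * (y i j)%:R.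

Definition assignment (a : 'I_n -> nat) (y : 'I_n -> 'I_m -> nat) : bool :=
  [forall i, \sum_j y i j <= a i]%N && [forall j, \sum_i u i j * (y i j)%:R <= c j].

(** An assignment is bounded by the number of customers, so the maximum is over a
    finite type. *)
Lemma best_assignment_exists (a : 'I_n -> nat) :
  exists y, assignment a y /\
    forall y', assignment a y' -> total_usage y' <= total_usage y.
Proof.
pose V := (\sum_i a i)%N.
pose val (z : {ffun 'I_n * 'I_m -> 'I_V.+1}) i j : nat := z (i, j).
pose z0 : {ffun 'I_n * 'I_m -> 'I_V.+1} := [ffun=> ord0].
have z0P : assignment a (val z0).
  apply/andP; split; apply/forallP => k.
    by rewrite big1// => j _; rewrite /val ffunE.
  rewrite big1 => [|i _]; first by case: vI => _ /(_ k)/ltW.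
  by rewrite /val ffunE mulr0.
pose z := [arg max_(z > z0 | assignment a (val z)) total_usage (val z)]%O.
exists (val z); rewrite /z; case: arg_maxP => //= z1 z1P z1max.
split=> // y' y'P.
have y'V i j : (y' i j < V.+1)%N.
  have /andP[/forallP/(_ i) yi _] := y'P.
  rewrite ltnS (leq_trans _ (leq_trans yi _))//.
    by rewrite (bigD1 j)//= leq_addr.
  by rewrite /V (bigD1 i)//= leq_addr.
pose z' : {ffun 'I_n * 'I_m -> 'I_V.+1} := [ffun p => Ordinal (y'V p.1 p.2)].
have zE : val z' = y'.
  by apply/funext => i; apply/funext => j; rewrite /val ffunE.
by have := z1max z'; rewrite zE; apply.
Qed.

Definition best_assignment (a : 'I_n -> nat) : 'I_n -> 'I_m -> nat :=
  projT1 (cid (best_assignment_exists a)).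

Lemma best_assignmentP a : assignment a (best_assignment a).
Proof. by rewrite /best_assignment; case: cid => y []. Qed.

Lemma best_assignment_max a y : assignment a y ->
  total_usage y <= total_usage (best_assignment a).
Proof. by rewrite /best_assignment; case: cid => y' /= [_]; apply. Qed.

Lemma total_usage_ge0 y : 0 <= total_usage y.
Proof. by rewrite !sumr_ge0// => i _; rewrite sumr_ge0// => j _; rewrite mulr_ge0. Qed.

(** An offline solution only matters through its numbers of assignments. *)
Lemma opt_types_le (s : seq 'I_n) :
  opt_types I s <= total_usage (best_assignment (fun i => count_mem i s)).
Proof.
rewrite /opt_types; apply: bigmax_le => [|f /forallP/= fP].
  exact: total_usage_ge0.
pose t k := tnth (in_tuple s) k.
pose y i j : nat := (\sum_k ((t k == i) && (f k == Some j)))%N.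
have yE j : \sum_i u i j * (y i j)%:R = \sum_(k | f k == Some j) u (t k) j.
  under eq_bigr do rewrite natr_sum mulr_sumr.
  rewrite exchange_big/= [RHS]big_mkcond/=; apply: eq_bigr => k _.
  rewrite (bigD1 (t k))//= eqxx/= big1 ?addr0 => [|i ik].
    by case: (f k == Some j); rewrite ?mulr1 ?mulr0.
  by rewrite eq_sym (negbTE ik) mulr0.
have yP : assignment (fun i => count_mem i s) y.
  apply/andP; split; apply/forallP => k; last by rewrite yE; exact: fP.
  rewrite exchange_big/= -sum1_count [leqRHS]big_tnth [leqRHS]big_mkcond/=.
  apply: leq_sum => l _; rewrite -/(t l).
  case: (t l == k) => /=; last by rewrite big1.
  case: (f l) => [j|]; last by rewrite big1.
  by rewrite (bigD1 j)//= eqxx big1// => j' /negbTE; rewrite eq_sym => jj';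
    rewrite (_ : (Some j == Some j') = false).
apply: le_trans (best_assignment_max yP).
rewrite /total_usage exchange_big/=; under [leRHS]eq_bigr do rewrite yE.
rewrite le_eqVlt; apply/orP; left; apply/eqP.
rewrite /offline_value.
under [RHS]eq_bigr do rewrite big_mkcond/=.
rewrite exchange_big/=; apply: eq_bigr => k _.
case: (f k) => [j|]; last by rewrite big1.
rewrite (bigD1 j)//= eqxx big1 ?addr0// => j' /negbTE jj'.
by rewrite (_ : (Some j == Some j') = false)// -jj' eq_sym.
Qed.

End OfflineAssignment.

Section OptimumBound.
Context (R : realType) (disp : measure_display) (W : measurableType disp)
  (P : probability W R) (n m : nat) (I : instance R n m).
Variable N : 'I_n -> W -> nat.
Hypothesis vI : valid_instance I.
Hypothesis mN : forall i l, measurable [set w | N i w = l].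
Hypothesis L0 : forall i, 0 <= mean_arrivals I i.
Hypothesis PN : forall i l,
  P [set w | N i w = l] = (pois (mean_arrivals I i) l)%:E.

(** Averaging an optimal offline assignment over the sample paths yields a
    feasible solution of the linear program. *)
Lemma expected_best_le (x : 'I_n -> 'I_m -> R) : lp_optimal I x ->
  (\int[P]_w (total_usage I (best_assignment vI (N ^~ w)))%:E
    <= (lp_value I x)%:E)%E.
Proof.
move=> [_ xmax].
pose Y i j w : R := (best_assignment vI (N ^~ w) i j)%:R.
have Y0 i j w : 0 <= Y i j w by [].
have mY i j : measurable_fun setT (fun w => (Y i j w)%:E).
  pose G (ks : seq nat) : \bar R := (best_assignment vI
     (fun i => nth 0%N ks i) i j)%:R%:E.
  have -> : (fun w => (Y i j w)%:E) = fun w => G [seq N i w | i <- enum 'I_n].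
    apply/funext => w; rewrite /G /Y; congr (best_assignment _ _ _ _)%:R%:E.
    by apply/funext => k; rewrite (nth_map k) ?size_enum_ord// nth_ord_enum.
  exact: measurable_fun_counts.
have YN w i : \sum_j Y i j w <= (N i w)%:R.
  have /andP[/forallP/(_ i) H _] := best_assignmentP vI (N ^~ w).
  by rewrite /Y -natr_sum ler_nat.
have EN i : (\int[P]_w (N i w)%:R%:E = (mean_arrivals I i)%:E)%E.
  by rewrite (@integral_pois _ _ _ P _ N mN i (fun k => k%:R%:E)
    (mean_arrivals I i))// pexp_nat.
have Yf i j : (\int[P]_w (Y i j w)%:E \is a fin_num)%E.
  rewrite ge0_fin_numE ?integral_ge0//; last by move=> w _; rewrite lee_fin.
  apply: (@le_lt_trans _ _ (\int[P]_w (N i w)%:R%:E)%E); last by rewrite EN ltry.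
  apply: ge0_le_integral_lower => w; rewrite lee_fin//.
  by apply: le_trans (YN w i); rewrite (bigD1 j)//= lerDl sumr_ge0.
pose z i j := fine (\int[P]_w (Y i j w)%:E)%E.
have zE i j : (z i j)%:E = (\int[P]_w (Y i j w)%:E)%E by rewrite fineK.
have sumE (K : finType) (a : K -> R) (p : K -> 'I_n) (q : K -> 'I_m) :
    (forall k, 0 <= a k) ->
    ((\sum_k a k * z (p k) (q k))%:E =
     \int[P]_w (\sum_k a k * Y (p k) (q k) w)%:E)%E.
  move=> a0; under eq_integral do rewrite -sumEFin.
  rewrite ge0_integral_sum//; last 2 first.
  - by move=> k; under eq_fun do rewrite EFinM; exact: measurable_funeM.
  - by move=> k w _; rewrite lee_fin mulr_ge0.
  rewrite -sumEFin; apply: eq_bigr => k _.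
  under [RHS]eq_integral do rewrite EFinM.
  rewrite ge0_integralZl_EFin//; first by rewrite EFinM zE.
  by move=> w _; rewrite lee_fin.
have u0 i j : 0 <= usage I i j by case: vI => _ _ _ /(_ i j)/andP[].
have fz : lp_feasible I z.
  split.
  - move=> j; under eq_bigr do rewrite mulrC.
    rewrite -lee_fin (sumE _ (usage I ^~ j) id (fun=> j))//.
    apply: (@le_trans _ _ (\int[P]_w (capacity I j)%:E)%E); last first.
      by have := expectation_cst P (capacity I j); rewrite expectation.unlock => ->.
    apply: ge0_le_integral_lower => w; rewrite lee_fin.
      by rewrite sumr_ge0// => i _; rewrite mulr_ge0.
    by have /andP[_ /forallP/(_ j)] := best_assignmentP vI (N ^~ w).
  - move=> i; rewrite -lee_fin -EN.
    have := sumE _ (fun=> 1) (fun=> i) id (fun=> ler01).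
    under eq_bigr do rewrite mul1r; move=> ->.
    apply: ge0_le_integral_lower => w; rewrite lee_fin.
      by rewrite sumr_ge0// => j _; rewrite mul1r.
    by under eq_bigr do rewrite mul1r.
  - by move=> i j; rewrite fine_ge0// integral_ge0// => w _; rewrite lee_fin.
apply: le_trans (_ : (lp_value I z)%:E <= _)%E; last by rewrite lee_fin xmax.
have -> : lp_value I z = \sum_(p : 'I_n * 'I_m) usage I p.1 p.2 * z p.1 p.2.
  by rewrite /lp_value pair_big/=; apply: eq_bigr => p _; rewrite mulrC.
rewrite sumE; last by move=> p; exact: u0.
apply: ge0_le_integral_lower => w; rewrite lee_fin ?total_usage_ge0//.
by rewrite /total_usage pair_big.
Qed.

End OptimumBound.

(** * The competitive ratio *)

Section Environment.
Context (R : realType) (disp : measure_display) (W : measurableType disp)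
  (P : probability W R) (n m : nat) (I : instance R n m).
Variables (x : 'I_n -> 'I_m -> R) (path : W -> sample_path R n)
  (picks : W -> 'I_n -> nat -> option 'I_m).
Hypothesis vI : valid_instance I.
Hypothesis fx : lp_feasible I x.
Hypothesis env : mls_environment P I x path picks.
Local Notation T := (horizon I).
Local Notation L := (mean_arrivals I).

Let N i w := arrival_count path i `[0, T] w.
Let B j w i q := picks w i q == Some j.
Let r j i := x i j / L i.

Lemma mean_arrivals_ge0 i : 0 <= L i.
Proof.
rewrite fine_ge0// integral_ge0// => t /=; rewrite in_itv/= => tT.
by rewrite lee_fin; case: vI => _ _ /(_ i)[+ _] _; apply.
Qed.

Lemma lp_feasible_le i j : x i j <= L i.
Proof.
case: fx => _ /(_ i) xL x0; apply: le_trans xL.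
by rewrite (bigD1 j)//= lerDl sumr_ge0.
Qed.

Let x0 i j : 0 <= x i j. Proof. by case: fx. Qed.

Let r01 j i : 0 <= r j i <= 1.
Proof.
have := mean_arrivals_ge0 i; rewrite le_eqVlt => /predU1P[L0|L0].
  by rewrite /r -L0 invr0 mulr0 lexx ler01.
by rewrite divr_ge0 ?(ltW L0)//= ler_pdivrMr// mul1r lp_feasible_le.
Qed.

Let rL j i : r j i * L i = x i j.
Proof.
rewrite /r; have [L0|L0] := eqVneq (L i) 0; last by rewrite divfK.
rewrite L0 mulr0; apply/le_anti; rewrite x0/= -L0.
by rewrite lp_feasible_le.
Qed.

Lemma arrival_count_law i l : measurable [set w | N i w = l] /\
  P [set w | N i w = l] = (pois (L i) l)%:E.
Proof.
have [_ /(_ i)[pp _] _ _] := env.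
have mT : measurable (`[0, T] : set R) by exact: measurable_itv.
have [mN PN] := pp _ mT (@subset_refl _ _) [set l].
split; first exact: mN.
by have := PN; rewrite poisson_probE// mean_arrivals_ge0.
Qed.

Lemma measurable_picks j i q b : measurable [set w | B j w i q = b].
Proof.
have [_ _ /(_ i q)[mp _] _] := env.
have mt : measurable [set w | B j w i q = true].
  rewrite (_ : [set w | _] = [set w | picks w i q = Some j]); first exact: mp.
  by apply/seteqP; split => w /= /eqP.
case: b => //; rewrite (_ : [set w | _] = ~` [set w | B j w i q = true]).
  exact: measurableC.
by apply/seteqP; split => w /=; case: (B j w i q).
Qed.

Lemma picks_law j i q : P [set w | B j w i q = true] = (r j i)%:E.
Proof.
have [_ _ /(_ i q)[_ /(_ j) Pp] _] := env.
rewrite /r -Pp; congr (P _).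
by apply/seteqP; split => w /= /eqP.
Qed.

Lemma indep_atoms j : mutually_independent P (atoms N (B j)).
Proof.
have [_ _ _ ind] := env; move=> s E us sE; apply: ind => // k ks.
have := sE k ks; case: k {ks} => [i|[i q]] /= [b ->].
  apply: sub_sigma_algebra; exists `[0, T]%classic.
    by split; [exact: measurable_itv|].
  by exists [set b] => //; rewrite setTI.
exists [set o | (o == Some j) = b] => //; rewrite setTI.
by apply/seteqP; split.
Qed.

Lemma arrival_countE i w : N i w = count_mem i (map snd (path w)).
Proof.
have [/(_ w)[_ wf] _ _ _] := env.
rewrite /N /arrival_count /arrivals_in count_map; apply: eq_in_count => a ap /=.
rewrite mem_set ?andbT//=.
by rewrite in_itv/= wf.
Qed.

Lemma thinnedE j i w : thinned N (B j) i w =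
  count_mem i (requests j (routed (picks w) [::] (map snd (path w)))).
Proof. by rewrite count_mem_requests /routed_count -arrival_countE. Qed.

Lemma expected_OPT_le : lp_optimal I x ->
  ('E_P[fun w => OPT I (path w)] <= (lp_value I x)%:E)%E.
Proof.
move=> ox; rewrite expectation.unlock.
have mN i l : measurable [set w | N i w = l] by have [] := arrival_count_law i l.
have PN i l : P [set w | N i w = l] = (pois (L i) l)%:E.
  by have [] := arrival_count_law i l.
apply: le_trans (expected_best_le vI mN mean_arrivals_ge0 PN ox).
apply: ge0_le_integral_lower => w; rewrite lee_fin.
  exact: opt_types_ge0.
apply: le_trans (opt_types_le vI _) _.
by rewrite (_ : (fun i => _) = N ^~ w)//; apply/funext => i; rewrite arrival_countE.
Qed.

(** Each resource is bounded from below by a function of its numbers of requests,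
    which are independent Poisson variables with parameters x i j. *)
Lemma expected_MLS_ge (d : nat) (rsv : 'I_m -> reservation) : (0 < d)%N ->
  (forall i j, usage I i j <= capacity I j / d%:R) ->
  ((\sum_j capacity I j * Defs.ratio I d x j (rsv j))%:E <=
   'E_P[fun w => MLS I d rsv (picks w) (path w)])%E.
Proof.
move=> d0 ud; rewrite expectation.unlock.
have u0 i j : 0 <= usage I i j by case: vI => _ _ _ /(_ i j)/andP[].
pose s j := enum (eligible I d (rsv j) j).
have Gex j := cid (@ratio_minorant R n m I d x d0 vI ud fx j (rsv j)).
pose G j := projT1 (Gex j).
have G0 j ks : 0 <= G j ks by have [+ _ _] := projT2 (Gex j); apply.
have Ggr j reqs : G j [seq count_mem i reqs | i <- s j] <=
    greedy (eligible I d (rsv j) j) (usage I ^~ j) (capacity I j) reqs.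
  by have [_ + _] := projT2 (Gex j); apply.
have Gr j : ((capacity I j * Defs.ratio I d x j (rsv j))%:E <=
    iter_pexp [seq x i j | i <- s j] (fun ks => (G j ks)%:E))%E.
  by have [] := projT2 (Gex j).
have mN i l : measurable [set w | N i w = l] by have [] := arrival_count_law i l.
have PN i l : P [set w | N i w = l] = (pois (L i) l)%:E.
  by have [] := arrival_count_law i l.
pose H j w := (G j [seq thinned N (B j) i w | i <- s j])%:E.
have mT j i k : measurable [set w | thinned N (B j) i w = k].
  exact: (measurable_thinned mean_arrivals_ge0 (r01 j) mN (measurable_picks j)
    PN (picks_law j) (@indep_atoms j)).
have intH j : (\int[P]_w H j w =
    iter_pexp [seq x i j | i <- s j] (fun ks => (G j ks)%:E))%E.
  rewrite /H (integral_thinned mean_arrivals_ge0 (r01 j) mN (measurable_picks j)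
    PN (picks_law j) (@indep_atoms j) (G := fun ks => (G j ks)%:E));
    [|exact: enum_uniq|by move=> ks; rewrite lee_fin].
  by congr iter_pexp; apply: eq_map => i; rewrite rL.
rewrite -sumEFin.
apply: (@le_trans _ _ (\sum_j \int[P]_w H j w)%E).
  by apply: lee_sum => j _; rewrite intH.
rewrite -ge0_integral_sum//; last 2 first.
- by move=> j; exact: (measurable_fun_counts (mT j) (s j) (fun ks => (G j ks)%:E)).
- by move=> j w _; rewrite lee_fin.
apply: ge0_le_integral_lower => w.
  by rewrite sume_ge0// => j _; rewrite lee_fin.
rewrite sumEFin lee_fin /MLS admission_sum; apply: ler_sum => j _.
by under eq_map do rewrite thinnedE; exact: Ggr.
Qed.

End Environment.

Theorem corollary1 (R : realType) :
  exists2 eps : nat -> R^o,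
    eps =O_\oo (fun d : nat => d%:R^-1 : R^o) &
    forall (d n m : nat) (I : instance R n m) (x : 'I_n -> 'I_m -> R)
      (rsv : 'I_m -> reservation)
      (disp : measure_display) (W : measurableType disp) (P : probability W R)
      (path : W -> sample_path R n)
      (picks : W -> 'I_n -> nat -> option 'I_m),
      (2 <= d)%N ->
      valid_instance I ->
      (forall i j, usage I i j <= capacity I j / d%:R) ->
      lp_optimal I x ->
      mls_reservation I d x rsv ->
      mls_environment P I x path picks ->
      ((1 - (Num.sqrt (2 * pi * d%:R))^-1 + eps d)%:E
         * 'E_P[fun w => OPT I (path w)]
       <= 'E_P[fun w => MLS I d rsv (picks w) (path w)])%E.
Proof.
exists (fun d => - (2 / d%:R) : R^o).
  apply/eqO_exP; exists 2 => //; near=> d.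
  by rewrite normrN normrM normfV !ger0_norm.
move=> d n m I x rsv disp W P path picks d2 vI ud ox mr env.
have fx := ox.1.
have d0 : (0 < d)%N by exact: leq_trans d2.
set rho := 1 - _ + _.
have u0 i j : 0 <= usage I i j by case: vI => _ _ _ /(_ i j)/andP[].
have c0 j : 0 < capacity I j by case: vI.
have x0 i j : 0 <= x i j by case: fx.
have MLS_LP : ((rho * lp_value I x)%:E <=
    'E_P[fun w => MLS I d rsv (picks w) (path w)])%E.
  apply: le_trans (expected_MLS_ge vI fx env rsv d0 ud).
  rewrite lee_fin (lp_value_U_all I d) mulr_sumr; apply: ler_sum => j _.
  apply: le_trans (_ : capacity I j * Defs.ratio I d x j OpenToAll <= _).
    rewrite /= /ratio_all mulrA mulrCA divff ?gt_eqF// mulr1 mulrC.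
    rewrite ler_wpM2l//; first by rewrite U_allE sumr_ge0// => i _; rewrite mulr_ge0.
    exact: ratio_all_factor_ge.
  by rewrite ler_wpM2l ?mr// ltW.
(* For small d the factor may be negative, and the bound is then trivial. *)
have [rho0|rho0] := leP 0 rho.
  apply: le_trans MLS_LP; rewrite EFinM lee_wpmul2l//.
  exact: expected_OPT_le env ox.
apply: (@le_trans _ _ 0%E).
  rewrite mule_le0_ge0//; first by rewrite lee_fin ltW.
  by apply: expectation_ge0 => w; exact: opt_types_ge0.
apply: expectation_ge0 => w; rewrite /MLS admission_sum sumr_ge0// => j _.
exact: greedy_ge0.
Unshelve. all: by end_near. Qed.
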